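(* Let $0<\alpha<1$, $0\le\beta\le 1$, $\gamma=\alpha+\beta(1-\alpha)$, $\rho>0$, $x_0\in\mathbb{R}$. Let $\varphi:\mathbb{R}^{+}\times\mathbb{R}\to\mathbb{R}$ be a continuous function (possibly with a weak singularity with respect to $t$ at $t=0$) satisfying a Lipschitz condition $|\varphi(t,x)-\varphi(t,y)|\le A|x-y|$ with a constant $A>0$. Suppose there exists a constant $0\le\lambda<1$ such that $(\mathcal{M}x)(t)=t^{\lambda}\varphi(t,x(t))$ defines a continuous bounded map from $C_{1-\gamma,\rho}[0,T]$ into $C[0,T]$, where $T$ is a positive constant. Suppose moreover that there exist three non-negative continuous functions $f,g,\psi:[0,+\infty)\to[0,+\infty)$ such that $$|\varphi(t,x)|\le g(t)\,f(|x|)+\psi(t)\quad\text{for all } t>0,\ x\in\mathbb{R},$$ where $f(\eta)\le\eta$ for $\eta\ge0$. Then the initial value problem $${}_{\rho}D^{\alpha,\beta}_{0+}x(t)=\varphi(t,x(t)),\quad t>0,\qquad {}_{\rho}I^{1-\gamma}_{0+}x(t)\big|_{t=0}=x_0$$ has a solution in $C_{1-\gamma,\rho}[0,+\infty)$.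
   Context: $\mathbb{R}^+=(0,\infty)$. For a finite $T>0$, $C_{1-\gamma,\rho}[0,T]$ is the space of functions $x:(0,T]\to\mathbb{R}$ such that $(t^{\rho}/\rho)^{1-\gamma}x(t)$ belongs to $C[0,T]$ (i.e. extends continuously to $[0,T]$), with norm $\|x\|_{C_{1-\gamma,\rho}}=\max_{t\in[0,T]}|(t^{\rho}/\rho)^{1-\gamma}x(t)|$; $C[0,T]$ carries the sup norm. $C_{1-\gamma,\rho}[0,+\infty)$ is the set of functions $x:(0,\infty)\to\mathbb{R}$ such that $(t^{\rho}/\rho)^{1-\gamma}x(t)$ extends continuously to $[0,+\infty)$. Katugampola fractional integral of order $\sigma>0$: $({}_{\rho}I^{\sigma}_{0+}x)(t)=\frac{\rho^{1-\sigma}}{\Gamma(\sigma)}\int_0^t\frac{\tau^{\rho-1}x(\tau)}{(t^{\rho}-\tau^{\rho})^{1-\sigma}}\,d\tau$, $t>0$; ${}_{\rho}I^{0}_{0+}$ is the identity. Hilfer-Katugampola fractional derivative of order $\alpha$ and type $\beta$: ${}_{\rho}D^{\alpha,\beta}_{0+}x={}_{\rho}I^{\beta(1-\alpha)}_{0+}\big(t^{1-\rho}\tfrac{d}{dt}\big)\,{}_{\rho}I^{(1-\alpha)(1-\beta)}_{0+}x$. Note $1-\gamma=(1-\alpha)(1-\beta)$. The value ${}_{\rho}I^{1-\gamma}_{0+}x(t)|_{t=0}$ is understood as the limit as $t\to0^+$. A solution satisfies the differential equation on $(0,\infty)$ together with the initial condition. The paper treats the problem through the corresponding Volterra equation $x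(t)=\frac{x_0}{\Gamma(\gamma)}(t^{\rho}/\rho)^{\gamma-1}+\frac{\rho^{1-\alpha}}{\Gamma(\alpha)}\int_0^t\frac{\tau^{\rho-1}\varphi(\tau,x(\tau))}{(t^{\rho}-\tau^{\rho})^{1-\alpha}}d\tau$.
   Formalization: For β>0 a solution in the literal sense can fail to exist (φ=w(t) of Weierstrass type); the equation is read as t^{1-ρ}(d/dt) I^{β(1-α)}(y−y(0+))=φ, with y=I^{1-γ}x, and literally whenever y is continuously differentiable on (0,∞) and the outer integral converges. *)

(* Defs.v *)
From HB Require Import structures.
From mathcomp Require Import all_boot all_order all_algebra.
From mathcomp Require Import all_classical all_reals all_analysis.

Set Implicit Arguments.
Unset Strict Implicit.
Unset Printing Implicit Defensive.

Import Order.TTheory GRing.Theory Num.Theory.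
Import numFieldNormedType.Exports.

Local Open Scope classical_set_scope.
Local Open Scope ring_scope.

(* Functions on (0, T] or (0, +oo) are represented by total functions R -> R
   whose values at t <= 0 are never used. *)

Definition Gamma (R : realType) (s : R) : R :=
  \int[@lebesgue_measure R]_(t in `]0, +oo[) (t `^ (s - 1) * expR (- t)).

(** Weighted spaces of continuous functions *)

Definition extend0 (R : realType) (u : R -> R) (t : R) : R :=
  if t == 0 then lim (u s @[s --> 0^'+]) else u t.

(* If u has no limit at 0+, then extend0 u is not continuous at 0, whatever the
   junk value of lim; so this says that u extends continuously to [0, T]. *)
Definition continuous_ext (R : realType) (T : R) (u : R -> R) : Prop :=
  {within `[0, T], continuous (extend0 u)}.

Definition sup_norm (R : realType) (T : R) (u : R -> R) : R :=
  sup [set `|extend0 u t| | t in `[0, T]].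

Definition weighted (R : realType) (gamma rho : R) (x : R -> R) (t : R) : R :=
  (t `^ rho / rho) `^ (1 - gamma) * x t.

Definition weighted_space (R : realType) (gamma rho T : R) (x : R -> R) : Prop :=
  continuous_ext T (weighted gamma rho x).

Definition weighted_norm (R : realType) (gamma rho T : R) (x : R -> R) : R :=
  sup_norm T (weighted gamma rho x).

Definition weighted_space_oo (R : realType) (gamma rho : R) (x : R -> R) : Prop :=
  {within `[0, +oo[, continuous (extend0 (weighted gamma rho x))}.

Definition superposition (R : realType) (lambda : R) (phi : R -> R -> R)
    (x : R -> R) (t : R) : R :=
  t `^ lambda * phi t (x t).

(* For a nonlinear map, bounded means that bounded sets have bounded images. *)
Definition continuous_bounded_map (R : realType) (gamma rho T : R)
    (M : (R -> R) -> (R -> R)) : Prop :=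
  [/\ forall x, weighted_space gamma rho T x -> continuous_ext T (M x),
      forall x, weighted_space gamma rho T x ->
        forall e, 0 < e -> exists2 d, 0 < d &
          forall y, weighted_space gamma rho T y ->
            weighted_norm gamma rho T (fun t => y t - x t) < d ->
            sup_norm T (fun t => M y t - M x t) < e
    & forall b, exists c, forall x, weighted_space gamma rho T x ->
        weighted_norm gamma rho T x <= b -> sup_norm T (M x) <= c].

(** Katugampola fractional integral *)

Definition katugampola_integrand (R : realType) (rho sigma : R) (x : R -> R)
    (t tau : R) : R :=
  tau `^ (rho - 1) * x tau / (t `^ rho - tau `^ rho) `^ (1 - sigma).

Definition katugampola (R : realType) (rho sigma : R) (x : R -> R) (t : R) : R :=
  if sigma == 0 then x t
  else rho `^ (1 - sigma) / Gamma sigma *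
    \int[@lebesgue_measure R]_(tau in `]0, t[)
      katugampola_integrand rho sigma x t tau.

(* The Lebesgue integral is a total function in the library: existence of the
   fractional integral has to be required separately. *)
Definition katugampola_defined (R : realType) (rho sigma : R) (x : R -> R) : Prop :=
  sigma = 0 \/
  forall t, 0 < t -> (@lebesgue_measure R).-integrable `]0, t[
    (EFin \o katugampola_integrand rho sigma x t).

(** Hilfer-Katugampola fractional derivative *)

Definition delta (R : realType) (rho : R) (u : R -> R) (t : R) : R :=
  t `^ (1 - rho) * derive1 u t.

Definition hilfer_inner (R : realType) (rho alpha beta : R) (x : R -> R) : R -> R :=
  katugampola rho ((1 - alpha) * (1 - beta)) x.

Definition hilfer_katugampola (R : realType) (rho alpha beta : R)
    (x : R -> R) : R -> R :=
  katugampola rho (beta * (1 - alpha)) (delta rho (hilfer_inner rho alpha beta x)).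

Definition hilfer_katugampola_classical (R : realType) (rho alpha beta : R)
    (x : R -> R) : Prop :=
  [/\ katugampola_defined rho ((1 - alpha) * (1 - beta)) x,
      forall t, 0 < t -> derivable (hilfer_inner rho alpha beta x) t 1,
      {within `]0, +oo[, continuous (delta rho (hilfer_inner rho alpha beta x))}
    & katugampola_defined rho (beta * (1 - alpha))
        (delta rho (hilfer_inner rho alpha beta x))].

(* With y := hilfer_inner x and sigma := beta (1 - alpha), one has
     I^sigma (delta y) = delta (I^sigma (y - y(0+)))
   as soon as y is regular enough for the left-hand side to make sense.  The
   right-hand side is the usual definition of the Caputo-Katugampola derivative
   of order 1 - sigma of y, and also covers functions y that are not
   differentiable.  This matters: if sigma > 0 and phi is merely continuous,
   then y need not be differentiable for the solution x of the Volterra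
   equation (take phi(t, x) = w(t) with w continuous and I^(1 - sigma) w
   nowhere differentiable), so that the problem has no solution in the
   classical sense.  For sigma = 0 both sides are delta y. *)
Definition hilfer_regular (R : realType) (rho alpha beta : R) (x : R -> R) : R -> R :=
  let y := hilfer_inner rho alpha beta x in
  katugampola rho (beta * (1 - alpha)) (fun t => y t - lim (y s @[s --> 0^'+])).

Definition hilfer_katugampola_ext (R : realType) (rho alpha beta : R)
    (x : R -> R) : R -> R :=
  delta rho (hilfer_regular rho alpha beta x).

Definition hilfer_katugampola_ext_defined (R : realType) (rho alpha beta : R)
    (x : R -> R) : Prop :=
  let y := hilfer_inner rho alpha beta x in
  [/\ katugampola_defined rho ((1 - alpha) * (1 - beta)) x,
      cvg (y s @[s --> 0^'+]),
      katugampola_defined rho (beta * (1 - alpha))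
        (fun t => y t - lim (y s @[s --> 0^'+]))
    & forall t, 0 < t -> derivable (hilfer_regular rho alpha beta x) t 1].

(** Initial value problem *)

(* The equation holds in the extended sense, and in the classical sense whenever
   I^(1 - gamma) x is continuously differentiable. *)
Definition ivp_solution (R : realType) (rho alpha beta gamma x0 : R)
    (phi : R -> R -> R) (x : R -> R) : Prop :=
  [/\ hilfer_katugampola_ext_defined rho alpha beta x,
      forall t, 0 < t -> hilfer_katugampola_ext rho alpha beta x t = phi t (x t),
      hilfer_katugampola_classical rho alpha beta x ->
        forall t, 0 < t -> hilfer_katugampola rho alpha beta x t = phi t (x t)
    & katugampola rho (1 - gamma) x t @[t --> 0^'+] --> x0].

(* Main.v *)
Require Import Defs.
From mathcomp Require Import all_boot all_order all_algebra.
From mathcomp Require Import all_classical all_reals all_analysis measurable_realfun.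
From mathcomp Require Import ring lra.

(** Since f 0 = 0, the growth condition bounds phi(t, 0) by psi(t), which is
    bounded on every (0, S]; with the Lipschitz condition in the second
    variable this makes the Volterra equation
      x = x0 / Gamma(gamma) (t^rho / rho)^(gamma - 1) + I^alpha (phi(., x))
    solvable by Picard iteration on the whole half line.  The iterates
    live in the class [dominated_by_power] of continuous functions on (0, oo)
    that are O(t^(rho (gamma - 1))) at the origin.  On (0, S] the Picard
    operator halves distances measured against the weight
    t^(rho (gamma - 1)) exp(k t^rho) for k large ([picard_contraction]):
    from exp(- k z) <= (k z)^(- p) with p = alpha / 2 one gains the factor
    k^(- p) at the price of replacing the order alpha of the integral by
    alpha - p > 0.  The iterates do not depend on S, hence converge on all of
    (0, oo) ([volterra_solution]).

    To pass from the Volterra equation to the differential equation put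
    sigma = beta (1 - alpha), w = phi(., x) and y = I^(1 - gamma) x.  The
    semigroup law I^a I^b = I^(a + b) and I^(1 - gamma) (t^rho / rho)^(gamma - 1)
    = Gamma(gamma) turn the equation into y = x0 + I^(1 - sigma) w
    ([inner_volterra]), so that y(0+) = x0, and then into
    I^sigma (y - x0) = I^1 w ([outer_volterra]); the fundamental theorem of
    calculus gives delta (I^1 w) = w.  When y is differentiable in the classical
    sense, y = x0 + I^1 (delta y), whence I^1 (I^sigma (delta y)) =
    I^sigma (I^1 (delta y)) = I^1 w, and both integrands are continuous, hence
    equal ([volterra_classical]).

    What this needs from fractional calculus is proved first, for functions that
    are continuous on (0, oo) and summable near 0 against t^(rho - 1) dt
    ([locally_summable]).  The semigroup law is Fubini's theorem together with
    the Beta integral of the kernels ([kern_comp]); its constant is identified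
    by Gamma(a) Gamma(b) = Gamma(a + b) B(a, b) ([eGammaM]), which also yields
    the convergence of the Beta integrals.  Continuity of I^s h
    ([abel_continuous]) comes from truncating the singularity of the kernel. *)

Set Implicit Arguments.
Unset Strict Implicit.
Unset Printing Implicit Defensive.
Import Order.TTheory GRing.Theory Num.Theory.
Import numFieldNormedType.Exports.
Local Open Scope classical_set_scope.
Local Open Scope ring_scope.

(** * Change of variables on open intervals *)

Section substitution.
Context {R : realType}.
Notation mu := (@lebesgue_measure R).
Implicit Types (a b : R) (F G : R -> R).

(** The exhaustion of an open interval used for integrals that are improper at
    both ends. *)
Lemma bigcup_itvcc_oo (a b : R) : a < b ->
  exists u v : nat -> R, [/\ forall n, a < u n /\ u n <= v n /\ v n < b,
    (forall m n, (m <= n)%N -> u n <= u m /\ v m <= v n) &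
    forall x, a < x < b -> exists n, u n <= x <= v n].
Proof.
move=> ab.
exists (fun n => a + (b - a) / n.+2%:R), (fun n => b - (b - a) / n.+2%:R); split.
- move=> n; have ba : 0 < b - a by rewrite subr_gt0.
  have n0 : 0 < (n.+2%:R)^-1 :> R by rewrite invr_gt0.
  have n2 : (n.+2%:R)^-1 <= 2^-1 :> R by rewrite lef_pV2 ?posrE// ler_nat.
  split; first by rewrite ltrDl mulr_gt0.
  split; last by rewrite ltrBlDr ltrDl mulr_gt0.
  have : (b - a) / n.+2%:R <= (b - a) / 2 by rewrite ler_pM2l.
  move: (_ / n.+2%:R) => e; lra.
- move=> m n mn.
  have : (b - a) / n.+2%:R <= (b - a) / m.+2%:R.
    by rewrite ler_pM2l ?subr_gt0// lef_pV2 ?posrE// ler_nat !ltnS.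
  by move: (_ / n.+2%:R) (_ / m.+2%:R) => e e' ee'; split; lra.
- move=> x /andP[ax xb].
  have ba : 0 < b - a by rewrite subr_gt0.
  set d := Num.min (x - a) (b - x).
  have d0 : 0 < d by rewrite lt_min !subr_gt0 ax xb.
  have [n _ hn] := near_infty_natSinv_lt (PosNum (divr_gt0 d0 ba)).
  exists n.
  have : (b - a) / n.+2%:R <= d.
    rewrite -ler_pdivlMl// mulrC ltW//.
    exact: (hn n.+1 (leqnSn n)).
  by rewrite le_min => /andP[]; move: (_ / n.+2%:R) => e; lra.
Qed.

(** The integrands may be singular at both end points, as the Beta integrand is:
    one substitutes on compact subintervals and exhausts. *)
Lemma ge0_substitution_oo F G a b c d : a < b ->
  {in `]a, b[, forall x, derivable F x 1} ->
  {in `]a, b[, continuous (derive1 F)} ->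
  {in `]a, b[ &, {homo F : x y / x < y}} ->
  {in `]a, b[, forall x, c < F x < d} ->
  (forall y, c < y < d -> exists2 x, a < x < b & F x = y) ->
  {in `]c, d[, continuous G} ->
  {in `]c, d[, forall y, 0 <= G y} ->
  (\int[mu]_(y in `]c, d[) (G y)%:E =
   \int[mu]_(x in `]a, b[) (G (F x) * derive1 F x)%:E)%E.
Proof.
move=> ab dF cF' incrF Fcd Fonto cG G0.
have [u [v [uv uvmon uvex]]] := bigcup_itvcc_oo ab.
have uab n : u n \in `]a, b[.
  rewrite in_itv/=; have [au [+ vb]] := uv n.
  by rewrite au => /le_lt_trans ->.
have vab n : v n \in `]a, b[.
  rewrite in_itv/=; have [au [+ vb]] := uv n.
  by rewrite vb andbT => uvn; exact: lt_le_trans uvn.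
have sub_ab n x : u n <= x <= v n -> x \in `]a, b[.
  move=> /andP[ux xv]; rewrite in_itv/=; apply/andP; split.
    by apply: lt_le_trans ux; have [] := uv n.
  by apply: le_lt_trans xv _; have [_ []] := uv n.
have leF : {in `]a, b[ &, {homo F : x y / x <= y}}.
  move=> x y xab yab; rewrite le_eqVlt => /predU1P[->//|xy].
  by rewrite ltW// incrF.
have eq1 : \bigcup_n `[u n, v n]%classic = `]a, b[%classic.
  apply/seteqP; split => x /=.
    by move=> [n _ /=]; rewrite !in_itv/= => /sub_ab; rewrite in_itv.
  by rewrite in_itv/= => /uvex[n xn]; exists n => //=; rewrite in_itv.
have Fwit y : c < y < d -> exists2 x, x \in `]a, b[ & F x = y.
  by move=> /Fonto[x xab <-]; exists x => //; rewrite in_itv.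
have eq2 : \bigcup_n `[F (u n), F (v n)]%classic = `]c, d[%classic.
  apply/seteqP; split => y /=.
    move=> [n _ /=]; rewrite !in_itv/= => /andP[Fuy yFv].
    have /andP[+ _] := Fcd _ (uab n); move=> /lt_le_trans/(_ Fuy) -> /=.
    by have /andP[_] := Fcd _ (vab n); exact: le_lt_trans.
  rewrite in_itv/= => /Fwit[x xab <-].
  have /uvex[n /andP[ux xv]] : a < x < b by move: xab; rewrite in_itv.
  by exists n => //=; rewrite in_itv/= !leF.
have cF x : x \in `]a, b[ -> {for x, continuous F}.
  by move=> /dF h; apply: differentiable_continuous; exact/derivable1_diffP.
have F'0 x : x \in `]a, b[ -> 0 <= derive1 F x.
  move=> xab; have dF' : {in (`]a, b[%classic : set R), forall x, derivable F x 1}.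
    by move=> y; rewrite inE/= => yab; exact: dF.
  exact: (@incr_derive1_ge0_itv R F false true a b x dF' incrF xab).
have mG : measurable_fun `]c, d[ G.
  apply: open_continuous_measurable_fun; first exact: interval_open.
  by move=> x; rewrite inE/=; exact: cG.
have mGF : measurable_fun `]a, b[ (fun x => G (F x) * derive1 F x).
  apply: open_continuous_measurable_fun; first exact: interval_open.
  move=> x; rewrite inE/= => xab; apply: continuousM; last exact: cF'.
  apply: continuous_comp; first exact: cF.
  by apply: cG; rewrite in_itv/=; exact: Fcd.
have FuFvcd n y : F (u n) <= y <= F (v n) -> y \in `]c, d[.
  move=> yF; suff : `]c, d[%classic y by [].
  by rewrite -eq2; exists n => //=; rewrite in_itv.
have cvg1 : (\int[mu]_(x in `[F (u n), F (v n)]) (G x)%:E)%E @[n --> \oo]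
    --> (\int[mu]_(y in `]c, d[) (G y)%:E)%E.
  rewrite -eq2; apply: ge0_nondecreasing_set_cvg_integral => //.
  - move=> m n mn; rewrite subsetEset => x /=; rewrite !in_itv/=.
    have [unm vmn] := uvmon _ _ mn.
    move=> /andP[Fx xF]; apply/andP; split.
      by apply: le_trans Fx; exact: leF.
    by apply: le_trans xF _; exact: leF.
  - move=> n; apply/measurable_EFinP; apply: measurable_funS mG => //.
    by rewrite -eq2; move=> x xn; exists n.
  - move=> n x /=; rewrite in_itv/= => /FuFvcd xcd.
    by rewrite lee_fin; exact: G0.
have cvg2 : (\int[mu]_(x in `[u n, v n]) (G (F x) * derive1 F x)%:E)%E @[n --> \oo]
    --> (\int[mu]_(x in `]a, b[) (G (F x) * derive1 F x)%:E)%E.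
  rewrite -eq1; apply: ge0_nondecreasing_set_cvg_integral => //.
  - move=> m n mn; rewrite subsetEset => x /=; rewrite !in_itv/=.
    have [unm vmn] := uvmon _ _ mn.
    by move=> /andP[ux xv]; rewrite (le_trans unm)//= (le_trans xv).
  - move=> n; apply/measurable_EFinP; apply: measurable_funS mGF => //.
    by rewrite -eq1; move=> x xn; exists n.
  - move=> n x /=; rewrite in_itv/= => /sub_ab xab.
    rewrite lee_fin mulr_ge0// ?F'0//; apply: G0.
    by rewrite in_itv/=; exact: Fcd.
apply: cvg_unique cvg1 _ => //; apply: cvg_trans cvg2.
apply: near_eq_cvg; apply: nearW => n.
have [au [uvn vb]] := uv n.
have sub x : u n < x < v n -> x \in `]a, b[.
  by move=> /andP[/ltW ux /ltW xv]; apply: (sub_ab n); rewrite ux.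
apply: esym.
apply: (@integration_by_substitution_increasing R F G (u n) (v n) uvn).
- move=> x y; rewrite !in_itv/= => /sub_ab xab /sub_ab yab; exact: incrF.
- by move=> x; rewrite in_itv/= => /sub xab; exact: (cF' _ xab).
- apply/cvg_ex; exists (derive1 F (u n)); apply: cvg_at_right_filter.
  exact: (cF' _ (uab n)).
- apply/cvg_ex; exists (derive1 F (v n)); apply: cvg_at_left_filter.
  exact: (cF' _ (vab n)).
- split.
  + by move=> x; rewrite in_itv/= => /sub xab; exact: (dF _ xab).
  + by apply: cvg_at_right_filter; exact: cF.
  + by apply: cvg_at_left_filter; exact: cF.
- apply: continuous_in_subspaceT => y; rewrite inE/= in_itv/= => /FuFvcd ycd.
  exact: (cG _ ycd).
Qed.
End substitution.

(** * The kernel and the incomplete Beta integral *)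

Section kernel.
Context {R : realType}.
Notation mu := (@lebesgue_measure R).
Implicit Types (a b r s t tau rho sigma : R).

(** Extended-real valued, so that convergence can be read off afterwards from
    its relation to the Gamma integral. *)
Definition Beta a b : \bar R :=
  (\int[mu]_(u in `]0%R, 1%R[) ((1 - u) `^ (a - 1) * u `^ (b - 1))%:E)%E.

(** The unnormalised kernel of the fractional integral of order sigma, extended
    by zero: every integral can then be taken over the whole line, with t a
    mere parameter.  It is locked so that unification never compares two kernels
    by unfolding real powers. *)
Definition kern : R -> R -> R -> R -> R := locked (fun rho sigma t tau =>
  if 0 < tau < t then tau `^ (rho - 1) * (t `^ rho - tau `^ rho) `^ (sigma - 1)
  else 0).

Lemma kern_def rho sigma t tau : kern rho sigma t tau =
  if 0 < tau < t then tau `^ (rho - 1) * (t `^ rho - tau `^ rho) `^ (sigma - 1)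
  else 0.
Proof. by rewrite /kern -lock. Qed.

Lemma ltr_powR rho s t : 0 < rho -> 0 <= s -> s < t -> s `^ rho < t `^ rho.
Proof.
move=> rho0 s0 st; apply: gt0_ltr_powR => //; rewrite nnegrE//.
by rewrite (le_trans s0)// ltW.
Qed.

Lemma powR_root rho s : 0 < rho -> 0 <= s -> (s `^ rho^-1) `^ rho = s.
Proof. by move=> rho0 s0; rewrite -powRrM mulVf ?gt_eqF// powRr1. Qed.

Lemma powRK rho s : 0 < rho -> 0 <= s -> (s `^ rho) `^ rho^-1 = s.
Proof. by move=> rho0 s0; rewrite -powRrM mulfV ?gt_eqF// powRr1. Qed.

Lemma continuous_powR rho s : 0 < s -> {for s, continuous (fun r => r `^ rho)}.
Proof.
move=> s0; apply: differentiable_continuous; apply/derivable1_diffP.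
by apply: derivable_powR; rewrite in_itv/= s0.
Qed.

Lemma for_continuousM (f g : R -> R) (x : R) :
  {for x, continuous f} -> {for x, continuous g} ->
  {for x, continuous (fun y => f y * g y)}.
Proof. by move=> cf cg; exact: continuousM. Qed.

Lemma for_continuousB (f g : R -> R) (x : R) :
  {for x, continuous f} -> {for x, continuous g} ->
  {for x, continuous (fun y => f y - g y)}.
Proof. by move=> cf cg; exact: continuousB. Qed.

Lemma for_continuous_powR c (f : R -> R) (x : R) : {for x, continuous f} -> 0 < f x ->
  {for x, continuous (fun r => f r `^ c)}.
Proof.
move=> cf fx0; apply: (@continuous_comp _ _ _ f (fun r => r `^ c)) => //.
exact: continuous_powR.
Qed.

Lemma powRD_gt0 (x c d : R) : 0 < x -> x `^ (c + d) = x `^ c * x `^ d.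
Proof. by move=> x0; rewrite powRD// (gt_eqF x0) implybT. Qed.

Lemma powRV (x c : R) : 0 <= x -> x^-1 `^ c = (x `^ c)^-1.
Proof. by move=> x0; rewrite -powR_inv1// powRAC powR_inv1 ?powR_ge0. Qed.

Lemma powR_weight rho g tau : 0 < rho ->
  (tau `^ rho / rho) `^ (g - 1) = rho `^ (1 - g) * tau `^ (rho * (g - 1)).
Proof.
move=> rho0; rewrite powRM ?powR_ge0 ?invr_ge0 ?ltW// powRV ?ltW//.
by rewrite -powRN opprB -powRrM mulrC.
Qed.

Lemma kern_ge0 rho sigma t tau : 0 <= kern rho sigma t tau.
Proof. by rewrite kern_def; case: ifP => // _; rewrite mulr_ge0// powR_ge0. Qed.

(** Substitution of u = (r^rho - tau^rho) / (t^rho - tau^rho) in the Beta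
    integral. *)
Lemma beta_integral rho a b tau t : 0 < rho -> 0 <= tau -> tau < t ->
  (\int[mu]_(r in `]tau, t[) (r `^ (rho - 1) * (t `^ rho - r `^ rho) `^ (a - 1) *
      (r `^ rho - tau `^ rho) `^ (b - 1))%:E =
  ((t `^ rho - tau `^ rho) `^ (a + b - 1) / rho)%:E * Beta a b)%E.
Proof.
move=> rho0 tau0 taut; set D := t `^ rho - tau `^ rho.
have D0 : 0 < D by rewrite subr_gt0 ltr_powR.
pose F r := (r `^ rho - tau `^ rho) / D.
have dF r : r \in `]tau, t[ -> is_derive r 1 F (rho * r `^ (rho - 1) / D).
  rewrite in_itv/= => /andP[taur _]; have r0 : 0 < r by exact: le_lt_trans taur.
  have /(is_deriveZ D^-1) := is_deriveB (is_derive1_powR rho r0) (is_derive_cst (tau `^ rho) r 1).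
  rewrite subr0 /GRing.scale/= mulrC; congr is_derive; apply/funext => x.
  by rewrite /F mulrC.
have F1 r : r \in `]tau, t[ -> derive1 F r = rho * r `^ (rho - 1) / D.
  by move=> rt; rewrite derive1E; apply: derive_val; exact: dF.
have posr r : r \in `]tau, t[ -> 0 < r.
  by rewrite in_itv/= => /andP[+ _]; exact: le_lt_trans.
have F01 r : r \in `]tau, t[ -> 0 < F r < 1.
  move=> /[dup]/posr r0; rewrite in_itv/= => /andP[taur rt].
  rewrite /F divr_gt0 ?subr_gt0 ?ltr_powR//=.
  by rewrite ltr_pdivrMr// mul1r ltrD2r ltr_powR// ltW.
have cF r : r \in `]tau, t[ -> {for r, continuous F}.
  move=> /dF h; apply: differentiable_continuous; apply/derivable1_diffP.
  exact: (@ex_derive _ _ _ _ _ _ _ h).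
have cF' r : r \in `]tau, t[ -> {for r, continuous (derive1 F)}.
  move=> rt; have : {for r, continuous (fun r => rho * r `^ (rho - 1) / D)}.
    apply: for_continuousM; last exact: cst_continuous.
    apply: for_continuousM; first exact: cst_continuous.
    by apply: continuous_powR; exact: posr.
  rewrite /prop_for /continuous_at F1//; apply: cvg_trans; apply: near_eq_cvg.
  by near=> x; rewrite F1//; near: x; exact: near_in_itvoo.
have cI r : r \in `]tau, t[ -> {for r, continuous (fun r : R =>
    (1 - F r) `^ (a - 1) * F r `^ (b - 1) * derive1 F r)}.
  move=> rt; have /andP[Fr0 Fr1] := F01 _ rt.
  apply: for_continuousM; last exact: cF'.
  apply: for_continuousM; last by apply: for_continuous_powR => //; exact: cF.
  apply: for_continuous_powR; last by rewrite subr_gt0.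
  by apply: for_continuousB; [exact: cst_continuous|exact: cF].
have cB y : 0 < y < 1 ->
    {for y, continuous (fun y : R => (1 - y) `^ (a - 1) * y `^ (b - 1))}.
  move=> /andP[y0 y1].
  apply: for_continuousM; last exact: continuous_powR.
  apply: for_continuous_powR; last by rewrite subr_gt0.
  by apply: for_continuousB; [exact: cst_continuous|move=> ?].
rewrite /Beta (@ge0_substitution_oo R F _ tau t 0 1 taut).
- rewrite -ge0_integralZl//=; last 3 first.
  + apply/measurable_EFinP; apply: open_continuous_measurable_fun.
      exact: interval_open.
    move=> r; rewrite inE/= => rt.
    exact: cI.
  + move=> r /= rt; rewrite lee_fin !mulr_ge0 ?powR_ge0// F1//.
    by rewrite !mulr_ge0 ?powR_ge0 ?invr_ge0 ?ltW.
  + by rewrite lee_fin divr_ge0// ?powR_ge0// ltW.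
  apply: eq_integral => r; rewrite inE/= => rt; rewrite -EFinM; congr EFin.
  rewrite F1//.
  have -> : 1 - F r = (t `^ rho - r `^ rho) / D.
    by rewrite /F /D; field; rewrite gt_eqF.
  move: rt; rewrite /F in_itv/= => /andP[taur rt].
  have r0 : 0 <= r by rewrite (le_trans tau0)// ltW.
  have tr : 0 <= t `^ rho - r `^ rho by rewrite subr_ge0 ltW// ltr_powR.
  have rtau : 0 <= r `^ rho - tau `^ rho by rewrite subr_ge0 ltW// ltr_powR.
  rewrite !powRM ?invr_ge0 ?(ltW D0)//.
  set X := (_ `^ (a - 1)); set Y := (_ `^ (b - 1)).
  have -> : a + b - 1 = (a - 1) + (b - 1) + 1 by ring.
  rewrite (powRD_gt0 (_ + _) 1)// (powRD_gt0 (a - 1))// powRr1 ?(ltW D0)//.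
  rewrite !powRV ?(ltW D0)//.
  set DA := D `^ (a - 1); set DB := D `^ (b - 1).
  have DA0 : DA != 0 by rewrite gt_eqF// powR_gt0.
  have DB0 : DB != 0 by rewrite gt_eqF// powR_gt0.
  by field; rewrite DA0 DB0 !gt_eqF.
- by move=> r /dF h; exact: (@ex_derive _ _ _ _ _ _ _ h).
- exact: cF'.
- move=> x y xt yt xy; rewrite /F ltr_pM2r ?invr_gt0// ltrD2r ltr_powR//.
  exact/ltW/posr.
- exact: F01.
- move=> y /andP[y0 y1]; exists ((tau `^ rho + y * D) `^ rho^-1).
    have yD : 0 < y * D < D by rewrite mulr_gt0//= gtr_pMl.
    have [yD0 yD1] := andP yD.
    apply/andP; split.
      rewrite -[X in X < _](powRK rho0 tau0); apply: ltr_powR; rewrite ?invr_gt0 ?powR_ge0//.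
      by rewrite ltrDl.
    rewrite -[X in _ < X](powRK rho0 (ltW (le_lt_trans tau0 taut))).
    apply: ltr_powR; rewrite ?invr_gt0 ?addr_ge0 ?powR_ge0 ?(ltW yD0)//.
    by rewrite -ltrBrDl.
  rewrite /F powR_root// ?addr_ge0 ?powR_ge0 ?mulr_ge0 ?(ltW y0) ?(ltW D0)//.
  by field; rewrite gt_eqF.
- by move=> y; rewrite in_itv/=; exact: cB.
- by move=> y _; rewrite mulr_ge0// powR_ge0.
Unshelve. all: by end_near. Qed.
End kernel.

(** * Composition of kernels *)

Section kernel_composition.
Context {R : realType}.
Notation mu := (@lebesgue_measure R).
Implicit Types (a b r s t tau rho sigma : R).

Lemma measurable_powR_comp d (X : measurableType d) (D : set X) (f : X -> R) c :
  measurable_fun D f -> measurable_fun D (fun x => f x `^ c).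
Proof. by move=> mf; exact: (measurableT_comp (measurable_powR c) mf). Qed.

Lemma measurable_kern2 rho s :
  measurable_fun setT (fun p : R * R => kern rho s p.1 p.2).
Proof.
under eq_fun do rewrite kern_def.
apply: measurable_fun_ifT => //.
  by apply: measurable_and; apply: measurable_fun_ltr => //.
apply: measurable_funM; first exact: measurable_powR_comp.
apply: measurable_powR_comp; apply: measurable_funB; exact: measurable_powR_comp.
Qed.

Lemma measurable_kernr rho s t : measurable_fun setT (kern rho s t).
Proof. exact: (measurableT_comp (measurable_kern2 rho s) (pair1_measurable t)). Qed.

Lemma measurable_kernl rho s tau : measurable_fun setT (kern rho s ^~ tau).
Proof. exact: (measurableT_comp (measurable_kern2 rho s) (pair2_measurable tau)). Qed.

Lemma kernE rho s t tau : 0 < tau < t ->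
  kern rho s t tau = tau `^ (rho - 1) * (t `^ rho - tau `^ rho) `^ (s - 1).
Proof. by rewrite kern_def => ->. Qed.

Lemma kern_out rho s t tau : ~~ (0 < tau < t) -> kern rho s t tau = 0.
Proof. by rewrite kern_def => /negbTE ->. Qed.

Lemma kern_mul0 rho a b t x y : ~~ ((0 < y < x) && (x < t)) ->
  kern rho a t x * kern rho b x y = 0.
Proof.
rewrite negb_and => /orP[/kern_out ->|xt]; first by rewrite mulr0.
by rewrite kern_out ?mul0r// negb_and xt orbT.
Qed.

(** The semigroup law at the level of kernels. *)
Lemma kern_comp rho a b t y : 0 < rho ->
  (\int[mu]_x (kern rho a t x * kern rho b x y)%:E =
    (kern rho (a + b) t y / rho)%:E * Beta a b)%E.
Proof.
move=> rho0; have [/andP[y0 yt]|yt] := boolP (0 < y < t); last first.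
  rewrite [in RHS]kern_out// mul0r mul0e integral0_eq// => x _.
  rewrite kern_mul0//; apply: contra yt => /andP[/andP[-> yx] xt].
  exact: lt_trans xt.
rewrite kernE ?y0//.
transitivity (\int[mu]_(x in `]y, t[) ((y `^ (rho - 1))%:E *
    (x `^ (rho - 1) * (t `^ rho - x `^ rho) `^ (a - 1) *
      (x `^ rho - y `^ rho) `^ (b - 1))%:E))%E.
  rewrite [RHS]integral_mkcond; apply: eq_integral => x _.
  rewrite patchE; case: ifPn; rewrite ?inE ?notin_setE/= in_itv/=.
    move=> /andP[yx xt]; rewrite -EFinM; congr (_%:E).
    have hx : 0 < x < t by rewrite (lt_trans y0 yx).
    have hy : 0 < y < x by rewrite y0.
    by rewrite (kernE _ _ hx) (kernE _ _ hy) mulrCA.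
  move=> /negP xn; rewrite kern_mul0//.
  by apply: contra xn => /andP[/andP[_ ->] ->].
transitivity ((y `^ (rho - 1))%:E * \int[mu]_(x in `]y, t[) (x `^ (rho - 1) *
    (t `^ rho - x `^ rho) `^ (a - 1) * (x `^ rho - y `^ rho) `^ (b - 1))%:E)%E.
  apply: ge0_integralZl.
  - exact: measurable_itv.
  - apply/measurable_EFinP; apply: measurable_funM; first apply: measurable_funM.
    + exact: measurable_powR_comp.
    + by apply: measurable_powR_comp; apply: measurable_funB => //; exact: measurable_powR_comp.
    + by apply: measurable_powR_comp; apply: measurable_funB => //; exact: measurable_powR_comp.
  - by move=> x _; rewrite lee_fin !mulr_ge0// powR_ge0.
  - by rewrite lee_fin powR_ge0.
by rewrite beta_integral// ?(ltW y0)// muleA -EFinM mulrA.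
Qed.

(** Translation invariance, used to turn a product of two Gamma integrals into
    a convolution. *)
Lemma lebesgue_measure_shift s (A : set R) : measurable A ->
  pushforward mu ((fun x => x - s) : _ -> measurableTypeR R) A = mu A.
Proof.
move=> mA.
apply/esym/lebesgue_measure_unique => //=.
  exact: measurable_funB.
move=> mshift _ [[a b]] _ <-.
rewrite /pushforward.
have -> : (fun x => x - s) @^-1` `]a, b]%classic = `]a + s, b + s]%classic.
  by apply/seteqP; split=> x /=; rewrite !in_itv/= ltrBrDr lerBlDr.
rewrite !lebesgue_measure_itv/= !lte_fin ltrD2r.
by case: ifP => // _; rewrite -!EFinB; congr EFin; ring.
Qed.

Lemma integral_shift (f : R -> \bar R) s : measurable_fun setT f ->
  (forall x, 0 <= f x)%E -> (\int[mu]_x f (x - s)%R = \int[mu]_x f x)%E.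
Proof.
move=> mf f0.
pose phi := (fun x => x - s) : measurableTypeR R -> measurableTypeR R.
have mphi : measurable_fun setT phi by exact: measurable_funB.
transitivity (\int[pushforward mu phi]_x f x)%E; last first.
  apply: eq_measure_integral => A mA _; exact: lebesgue_measure_shift.
apply/esym/(ge0_integral_pushforward mphi) => //.
Qed.
End kernel_composition.

(** * Euler's integrals *)

Section euler_integrals.
Context {R : realType}.
Notation mu := (@lebesgue_measure R).
Implicit Types (a b r s t tau rho sigma : R).

Lemma integral_gt0 d (X : measurableType d) (m : {measure set X -> \bar R})
    (D : set X) (f : X -> \bar R) : measurable D -> measurable_fun D f ->
  (0 < m D)%E -> (forall x, D x -> 0 < f x)%E -> (0 < \int[m]_(x in D) f x)%E.
Proof.
move=> mD mf mD0 f0; rewrite lt0e integral_ge0 ?andbT; last first.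
  by move=> x Dx; rewrite ltW// f0.
apply/eqP => fD0; have : (\int[m]_(x in D) `|f x| = 0)%E.
  rewrite -fD0; apply: eq_integral => x; rewrite inE => Dx.
  by rewrite gee0_abs// ltW// f0.
move/(ae_eq_integral_abs m mD mf) => [N [mN N0 DN]].
have DsubN : D `<=` N.
  by move=> x Dx; apply: DN => /(_ Dx) fx0; have := f0 _ Dx; rewrite fx0 ltxx.
have : (m D <= m N)%E by apply: le_measure; rewrite ?inE.
by rewrite N0 leNgt mD0.
Qed.

Lemma Beta_gt0 a b : (0 < Beta a b)%E.
Proof.
rewrite /Beta; apply: integral_gt0.
- exact: measurable_itv.
- apply/measurable_EFinP; apply: measurable_funM; apply: measurable_powR_comp => //.
  exact: measurable_funB.
- by have := @lebesgue_measure_itv R `]0, 1[; rewrite /= lte_fin ltr01 => ->; rewrite lte_fin subr0.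
- move=> x /=; rewrite in_itv/= => /andP[x0 x1].
  by rewrite lte_fin mulr_gt0// powR_gt0// subr_gt0.
Qed.

(** [Gamma] before passing to real numbers: here divergence is visible. *)
Definition eGamma s : \bar R :=
  (\int[mu]_(t in `]0%R, +oo[) (t `^ (s - 1) * expR (- t))%:E)%E.

Lemma GammaE s : Gamma s = fine (eGamma s).
Proof. by []. Qed.

Let gk s t : R := if 0 < t then t `^ (s - 1) * expR (- t) else 0.

Let gk_ge0 s t : 0 <= gk s t.
Proof. by rewrite /gk; case: ifP => // _; rewrite mulr_ge0 ?powR_ge0 ?expR_ge0. Qed.

Lemma measurable_Gamma_integrand s (D : set R) :
  measurable_fun D (fun t => t `^ (s - 1) * expR (- t)).
Proof.
apply: measurable_funM; first exact: measurable_powR_comp.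
by apply: measurableT_comp => //; exact: measurable_funN.
Qed.

Let measurable_gk s : measurable_fun setT (gk s).
Proof.
apply: measurable_fun_ifT => //; first exact: measurable_fun_ltr.
exact: measurable_Gamma_integrand.
Qed.

Let eGamma_gk s : eGamma s = (\int[mu]_t (gk s t)%:E)%E.
Proof.
rewrite /eGamma integral_mkcond; apply: eq_integral => t _.
rewrite patchE /gk; case: ifPn; rewrite ?inE ?notin_setE/= in_itv/= andbT.
  by move=> ->.
by move=> /negP/negbTE ->.
Qed.

Lemma eGamma_gt0 s : (0 < eGamma s)%E.
Proof.
apply: integral_gt0.
- exact: measurable_itv.
- by apply/measurable_EFinP; exact: measurable_Gamma_integrand.
- by have := @lebesgue_measure_itv R `]0, +oo[; rewrite /= ltry => ->; exact: ltry.
- move=> x /=; rewrite in_itv/= andbT => x0.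
  by rewrite lte_fin mulr_gt0 ?powR_gt0 ?expR_gt0.
Qed.

(** With r replaced by r - s, the product of the two integrals becomes the
    integral over r of exp(- r) times the convolution of the two powers on
    (0, r); by Tonelli and homogeneity the latter is r^(a + b - 1) B. *)
Lemma eGammaM a b : (eGamma a * eGamma b = eGamma (b + a) * Beta b a)%E.
Proof.
transitivity (\int[mu]_s \int[mu]_r (gk a s * gk b (r - s))%:E)%E.
  rewrite eGamma_gk -ge0_integralZr; last first.
  - exact/ltW/eGamma_gt0.
  - by move=> x _; rewrite lee_fin gk_ge0.
  - by apply/measurable_EFinP; exact: measurable_gk.
  - exact: measurableT.
  apply: eq_integral => s _; rewrite eGamma_gk.
  rewrite -(@integral_shift _ (fun r => (gk b r)%:E) s); last first.
  - by move=> x; rewrite lee_fin gk_ge0.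
  - by apply/measurable_EFinP; exact: measurable_gk.
  rewrite -ge0_integralZl//.
  - by apply/measurable_EFinP; apply: measurableT_comp => //; exact: measurable_funB.
  - by move=> x _; rewrite lee_fin gk_ge0.
  - by rewrite lee_fin gk_ge0.
transitivity (\int[mu]_r \int[mu]_s (gk a s * gk b (r - s))%:E)%E.
  pose f := fun p : R * R => (gk a p.1 * gk b (p.2 - p.1))%:E.
  have mf : measurable_fun setT f.
    apply/measurable_EFinP; apply: measurable_funM; first exact: measurableT_comp.
    by apply: measurableT_comp => //; exact: measurable_funB.
  have f0 p : (0 <= f p)%E by rewrite lee_fin mulr_ge0 ?gk_ge0.
  exact: (@fubini_tonelli _ _ _ _ _ lebesgue_measure lebesgue_measure f mf f0).
rewrite eGamma_gk -ge0_integralZr; last first.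
- exact/ltW/Beta_gt0.
- by move=> x _; rewrite lee_fin gk_ge0.
- by apply/measurable_EFinP; exact: measurable_gk.
- exact: measurableT.
apply: eq_integral => r _.
rewrite {3}/gk; case: ifPn => r0; last first.
  rewrite mul0e integral0_eq// => s _; rewrite /gk.
  have [s0|s0] := ltP 0 s; last by rewrite mul0r.
  by rewrite subr_gt0 ltNge (le_trans _ (ltW s0)) ?mulr0// leNgt.
transitivity (\int[mu]_(s in `]0%R, r[) ((expR (- r))%:E *
  (s `^ (1 - 1) * (r `^ 1 - s `^ 1) `^ (b - 1) * (s `^ 1 - 0 `^ 1) `^ (a - 1))%:E))%E.
  rewrite [RHS]integral_mkcond; apply: eq_integral => s _.
  rewrite patchE; case: ifPn; rewrite ?inE ?notin_setE/= in_itv/=.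
    move=> /andP[s0 sr]; rewrite -EFinM; congr (_%:E).
    rewrite /gk s0 subr_gt0 sr subrr powRr0 powR0 ?oner_neq0// subr0 !powRr1 ?ltW//.
    have -> : - r = - s + - (r - s) by ring.
    by rewrite expRD; ring.
  move=> /negP; rewrite /gk subr_gt0 negb_and => /orP[/negbTE ->|/negbTE ->].
    by rewrite mul0r.
  by rewrite mulr0.
transitivity ((expR (- r))%:E * \int[mu]_(s in `]0%R, r[)
  (s `^ (1 - 1) * (r `^ 1 - s `^ 1) `^ (b - 1) * (s `^ 1 - 0 `^ 1) `^ (a - 1))%:E)%E.
  apply: ge0_integralZl.
  - exact: measurable_itv.
  - apply/measurable_EFinP; apply: measurable_funM; first apply: measurable_funM.
    + exact: measurable_powR_comp.
    + by apply: measurable_powR_comp; apply: measurable_funB => //; exact: measurable_powR_comp.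
    + by apply: measurable_powR_comp; apply: measurable_funB => //; exact: measurable_powR_comp.
  - by move=> x _; rewrite lee_fin !mulr_ge0// powR_ge0.
  - by rewrite lee_fin expR_ge0.
rewrite beta_integral// powR0 ?oner_neq0// subr0 powRr1 ?ltW// divr1.
by rewrite muleA -EFinM; congr (_%:E * _)%E; rewrite mulrC.
Qed.

Lemma eGamma1 : eGamma 1 = 1%E.
Proof.
rewrite -(@integral_exponential_pdf R 1 ltr01) /exponential_pdf.
rewrite (_ : (fun x => _) = (fun x => (1 * expR (- 1 * x))%:E) \_ `[0%R, +oo[); last first.
  by rewrite restrict_EFin.
rewrite -integral_mkcond -integral_itv_obnd_cbnd.
  apply: eq_integral => x _; congr (_%:E).
  by rewrite subrr powRr0 mulN1r.
apply/measurable_EFinP; apply: measurable_funM => //.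
by apply: measurableT_comp => //; exact: measurable_funM.
Qed.

(** The integrand is at most t^(s - 1) on (0, 1) and at most exp(- t) beyond;
    the first bound uses the case a = b = 1, rho = s of the Beta integral. *)
Lemma eGamma_fin s : 0 < s <= 1 -> eGamma s \is a fin_num.
Proof.
move=> /andP[s0 s1]; rewrite ge0_fin_numE; last exact/ltW/eGamma_gt0.
pose p t : R := if 0 < t < 1 then t `^ (s - 1) else 0.
have mp : measurable_fun setT p.
  apply: measurable_fun_ifT => //.
  by apply: measurable_and; exact: measurable_fun_ltr.
have p0 t : 0 <= p t by rewrite /p; case: ifP => // _; exact: powR_ge0.
have pdf0 t : 0 <= exponential_pdf 1 t :> R by apply: exponential_pdf_ge0.
have mpdf : measurable_fun setT (exponential_pdf (1 : R)).
  exact: measurable_exponential_pdf.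
apply: (@le_lt_trans _ _ (\int[mu]_t ((p t)%:E + (exponential_pdf 1 t)%:E))%E).
  rewrite eGamma_gk; apply: ge0_le_integral => //.
  - by move=> t _; rewrite lee_fin gk_ge0.
  - by apply/measurable_EFinP; exact: measurable_gk.
  - by apply: emeasurable_funD; exact/measurable_EFinP.
  - move=> t _; rewrite -EFinD lee_fin /gk; case: ifP => t0; last exact: addr_ge0.
    rewrite /exponential_pdf patchE ifT ?inE/= ?in_itv/= ?(ltW t0)//.
    rewrite mulN1r mul1r /p t0/=; case: ltP => t1.
      rewrite (@le_trans _ _ (t `^ (s - 1)))//; last by rewrite lerDl expR_ge0.
      by rewrite ler_piMr ?powR_ge0// expR_le1 oppr_le0 ltW.
    rewrite add0r ler_piMl ?expR_ge0//.
    by rewrite -[leRHS](powRr0 t) ler_powR// subr_le0.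
rewrite ge0_integralD//; last 4 first.
- by move=> t _; rewrite lee_fin.
- exact/measurable_EFinP.
- by move=> t _; rewrite lee_fin.
- exact/measurable_EFinP.
rewrite integral_exponential_pdf// lte_add_pinfty ?ltry//.
rewrite (_ : (\int[mu]_t (p t)%:E)%E = \int[mu]_(r in `]0%R, 1%R[) (r `^ (s - 1) *
   (1 `^ s - r `^ s) `^ (1 - 1) * (r `^ s - 0 `^ s) `^ (1 - 1))%:E)%E.
  rewrite (beta_integral _ _ s0)// /Beta.
  rewrite (eq_integral (cst 1%E)) ?integral_cst//=; last first.
    by move=> u _; rewrite subrr !powRr0 mulr1.
  rewrite mul1e lebesgue_measure_itv/= lte_fin ltr01 -EFinD -EFinM.
  exact: ltry.
rewrite [RHS]integral_mkcond; apply: eq_integral => t _.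
rewrite patchE; case: ifPn; rewrite ?inE ?notin_setE/= in_itv/= /p.
  by move=> ->; rewrite subrr !powRr0 !mulr1.
by move=> /negP/negbTE ->.
Qed.

End euler_integrals.

(** * Fractional integrals *)

Section abel_operator.
Context {R : realType}.
Notation mu := (@lebesgue_measure R).
Implicit Types (a b r s t tau rho sigma : R) (h : R -> R).

(** In Gamma(a) Gamma(b) = Gamma(a + b) B(a, b) the left side is finite and both
    factors on the right are positive, so neither can be infinite. *)
Lemma eGamma_Beta_fin a b : 0 < a <= 1 -> 0 < b <= 1 ->
  (eGamma (a + b) \is a fin_num) * (Beta a b \is a fin_num).
Proof.
move=> a01 b01; have := eGammaM b a; have := Beta_gt0 a b; have := eGamma_gt0 (a + b).
rewrite -(fineK (eGamma_fin a01)) -(fineK (eGamma_fin b01)) -EFinM.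
by case: (eGamma (a + b)) (Beta a b) => [x| |] [y| |]//=;
  rewrite ?lte_fin => ? ?; rewrite ?gt0_muley ?gt0_mulye ?lte_fin.
Qed.

Definition beta a b : R := fine (Beta a b).

Lemma BetaE a b : 0 < a <= 1 -> 0 < b <= 1 -> Beta a b = (beta a b)%:E.
Proof. by move=> a01 b01; rewrite fineK// eGamma_Beta_fin. Qed.

Lemma beta_gt0 a b : 0 < a <= 1 -> 0 < b <= 1 -> 0 < beta a b.
Proof. by move=> a01 b01; rewrite -lte_fin -BetaE// Beta_gt0. Qed.

Lemma Gamma_gt0 s : 0 < s <= 1 -> 0 < Gamma s.
Proof. by move=> s01; rewrite GammaE fine_gt0// eGamma_gt0 ltey_eq eGamma_fin. Qed.

Lemma GammaM a b : 0 < a <= 1 -> 0 < b <= 1 ->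
  Gamma a * Gamma b = Gamma (a + b) * beta a b.
Proof.
move=> a01 b01; have [abfin Bfin] := eGamma_Beta_fin a01 b01.
have := eGammaM b a.
rewrite -(fineK (eGamma_fin a01)) -(fineK (eGamma_fin b01)) -(fineK abfin) (BetaE a01 b01).
rewrite -2!EFinM => -[E]; rewrite mulrC; exact: E.
Qed.

Lemma Gamma1 : Gamma 1 = 1 :> R.
Proof. by rewrite GammaE eGamma1. Qed.

(** A local uniform limit of functions continuous at t is continuous at t. *)
Lemma continuous_uniform_approx h t :
  (forall e, 0 < e -> exists G : R -> R, {for t, continuous G} /\
     \forall s \near t, `|h s - G s| <= e) -> {for t, continuous h}.
Proof.
move=> hG; apply/cvgrPdist_le => e e0.
have [G [cG hGe]] := hG (e / 3) (divr_gt0 e0 (ltr0n _ 3)).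
have hGt := nbhs_singleton hGe.
move/cvgrPdist_le : cG => /(_ (e / 3) (divr_gt0 e0 (ltr0n _ 3))) cG.
near=> s.
have H1 : `|h s - G s| <= e / 3 by near: s.
have H2 : `|G t - G s| <= e / 3 by near: s.
have -> : h t - h s = (h t - G t) + (G t - G s) - (h s - G s) by ring.
rewrite (le_trans (ler_normB _ _))// (le_trans (lerD (ler_normD _ _) H1))//.
by rewrite (le_trans (lerD (lerD hGt H2) (lexx _)))// le_eqVlt; apply/orP; left; apply/eqP; field.
Unshelve. all: by end_near. Qed.

Definition pos_continuous h := forall t, 0 < t -> {for t, continuous h}.

Lemma pos_continuous_bounded h l t : pos_continuous h -> 0 < l ->
  exists2 M, 0 <= M & forall s, l <= s <= t -> `|h s| <= M.
Proof.
move=> ch l0.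
have : compact (h @` `[l, t]).
  apply: continuous_compact; last exact: segment_compact.
  apply: continuous_in_subspaceT => s; rewrite inE/= in_itv/= => /andP[ls _].
  exact/ch/(lt_le_trans l0).
move/compact_bounded => [M [_ MH]].
exists (Num.max 0 (M + 1)); first by rewrite le_max lexx.
move=> s lst; rewrite le_max; apply/orP; right; apply: (MH (M + 1)).
  by rewrite ltrDl.
by exists s => //=; rewrite in_itv.
Qed.

Lemma measurable_pos_continuous h : pos_continuous h ->
  measurable_fun setT (h \_ `]0, +oo[).
Proof.
move=> ch; apply/(measurable_restrictT _ _).1 => //.
apply: open_continuous_measurable_fun; first exact: interval_open.
by move=> x; rewrite inE/= in_itv/= andbT; exact: ch.
Qed.

(** The fractional integral without its constant rho^(1 - s) / Gamma(s). *)
Definition abel rho s h t : R := \int[mu]_tau (kern rho s t tau * h tau).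

Definition abel_integrable rho s h t :=
  mu.-integrable setT (fun tau => (kern rho s t tau * h tau)%:E).

(** The values of h on the negative half line are arbitrary, possibly not
    measurable; the kernel ignores them. *)
Lemma kern_patch rho s h t tau :
  kern rho s t tau * h tau = kern rho s t tau * (h \_ `]0, +oo[) tau.
Proof.
have [/andP[tau0 _]|taut] := boolP (0 < tau < t); last by rewrite kern_out// !mul0r.
by rewrite patchE ifT// inE/= in_itv/= tau0.
Qed.

Lemma measurable_kernM rho s h t : pos_continuous h ->
  measurable_fun setT (fun tau => kern rho s t tau * h tau).
Proof.
move=> ch; under eq_fun do rewrite kern_patch.
apply: measurable_funM; first exact: measurable_kernr.
exact: measurable_pos_continuous.
Qed.

Lemma abel_integrableP rho s h t : pos_continuous h ->
  (\int[mu]_tau (kern rho s t tau * `|h tau|)%:E < +oo)%E ->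
  abel_integrable rho s h t.
Proof.
move=> ch hoo; apply/integrableP; split.
  by apply/measurable_EFinP; exact: measurable_kernM.
apply: le_lt_trans hoo; rewrite le_eqVlt; apply/orP; left; apply/eqP.
by apply: eq_integral => tau _; rewrite abse_EFin normrM (ger0_norm (kern_ge0 _ _ _ _)).
Qed.

(** The fractional integral of a power, including its convergence or
    divergence. *)
Lemma kern_power rho a b t : 0 < rho -> 0 < t ->
  (\int[mu]_tau (kern rho a t tau * tau `^ (rho * (b - 1)))%:E =
   ((t `^ rho) `^ (a + b - 1) / rho)%:E * Beta a b)%E.
Proof.
move=> rho0 t0.
have := beta_integral a b rho0 (lexx 0) t0; rewrite powR0 ?gt_eqF// subr0 => <-.
rewrite [RHS]integral_mkcond; apply: eq_integral => r _.
rewrite patchE; case: ifPn; rewrite ?inE ?notin_setE/= in_itv/=.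
  by move=> rt; rewrite (kernE _ _ rt) subr0 powRrM.
by move=> /negP rt; rewrite kern_out// mul0r.
Qed.
End abel_operator.

(** * Locally summable functions and the semigroup law *)

Section abel_semigroup.
Context {R : realType}.
Notation mu := (@lebesgue_measure R).
Implicit Types (a b r s t tau rho sigma : R) (h : R -> R).

(** Order 1 means summability against tau^(rho - 1) dtau; it implies summability
    for every positive order. *)
Definition locally_summable rho h :=
  pos_continuous h /\ forall t, 0 < t -> abel_integrable rho 1 h t.

Lemma kern_integrable rho s t : 0 < rho -> 0 < s <= 1 -> 0 < t ->
  mu.-integrable setT (EFin \o kern rho s t).
Proof.
move=> rho0 s01 t0; apply/integrableP; split.
  by apply/measurable_EFinP; exact: measurable_kernr.
have := kern_power s 1 rho0 t0.
rewrite BetaE// ?ltr01 ?lexx// -EFinM subrr mulr0 => E.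
rewrite [X in (X < _)%E](_ : _ = \int[mu]_tau (kern rho s t tau * tau `^ 0)%:E)%E.
  by rewrite E ltry.
apply: eq_integral => tau _.
by rewrite /= powRr0 mulr1 ger0_norm// kern_ge0.
Qed.

Lemma ler_powR_neg (c x y : R) : c <= 0 -> 0 < x -> x <= y -> y `^ c <= x `^ c.
Proof.
move=> c0 x0 xy; have y0 := lt_le_trans x0 xy.
rewrite -[c]opprK (powRN y) (powRN x) lef_pV2 ?posrE ?powR_gt0//.
by apply: ge0_ler_powR; rewrite ?oppr_ge0// nnegrE ltW.
Qed.

Lemma kern_le1 rho s t tau : 0 < rho -> 1 <= s ->
  kern rho s t tau <= (t `^ rho) `^ (s - 1) * kern rho 1 t tau.
Proof.
move=> rho0 s1.
have [/[dup] taut /andP[tau0 ltt]|taut] := boolP (0 < tau < t); last first.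
  by rewrite !kern_out// mulr0.
rewrite !(kernE _ _ taut) (subrr 1) powRr0 mulr1 mulrC ler_wpM2r ?powR_ge0//.
apply: ge0_ler_powR; rewrite ?subr_ge0// ?nnegrE ?subr_ge0 ?powR_ge0//.
  by rewrite ltW// ltr_powR// ltW.
by rewrite gerBl powR_ge0.
Qed.

Lemma kern_le1_far rho s t l tau : 0 < rho -> s <= 1 -> 0 < l -> l < t -> tau <= l ->
  kern rho s t tau <= (t `^ rho - l `^ rho) `^ (s - 1) * kern rho 1 t tau.
Proof.
move=> rho0 s1 l0 lt taul.
have [/[dup] taut /andP[tau0 ltt]|taut] := boolP (0 < tau < t); last first.
  by rewrite !kern_out// mulr0.
rewrite !(kernE _ _ taut) (subrr 1) powRr0 mulr1 mulrC.
apply: ler_wpM2r; first exact: powR_ge0.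
have tl : 0 < t `^ rho - l `^ rho by rewrite subr_gt0 ltr_powR// ltW.
have ttau : t `^ rho - l `^ rho <= t `^ rho - tau `^ rho.
  apply: lerB; first exact: lexx.
  by apply: ge0_ler_powR; rewrite ?nnegrE ?(ltW rho0) ?(ltW tau0) ?(ltW l0).
by apply: ler_powR_neg; rewrite // subr_le0.
Qed.

(** Only the end point tau = t is at stake when s < 1: there h is bounded and the
    kernel is integrable, while the kernel is bounded by a multiple of the kernel
    of order 1 on (0, t / 2). *)
Lemma locally_summable_integrable rho s h t : 0 < rho -> locally_summable rho h ->
  0 < s -> 0 < t -> abel_integrable rho s h t.
Proof.
move=> rho0 [ch ih] s0 t0; have [s1|s1] := leP 1 s.
  have := @integrableZl _ _ _ mu _ measurableT ((t `^ rho) `^ (s - 1)) _ (ih _ t0).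
  apply: le_integrable => //.
    by apply/measurable_EFinP; exact: measurable_kernM.
  move=> tau _ /=; rewrite lee_fin mulrA !normrM.
  rewrite ler_wpM2r// !ger0_norm ?powR_ge0 ?kern_ge0//.
  exact: kern_le1.
have t2 : 0 < t / 2 by rewrite divr_gt0.
have [M M0 hM] := @pos_continuous_bounded R h (t / 2) t ch t2.
have s01 : 0 < s <= 1 by rewrite s0 ltW.
have I1 := @integrableZl _ _ _ mu _ measurableT
  ((t `^ rho - (t / 2) `^ rho) `^ (s - 1)) _ (integrable_abse (ih _ t0)).
have I2 := @integrableZl _ _ _ mu _ measurableT M _ (kern_integrable rho0 s01 t0).
have := integrableD measurableT I1 I2.
apply: le_integrable => //.
  by apply/measurable_EFinP; exact: measurable_kernM.
move=> tau _ /=; rewrite lee_fin.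
rewrite normrM (ger0_norm (kern_ge0 _ _ _ _)).
rewrite [X in _ <= X]ger0_norm; last first.
  by rewrite addr_ge0// mulr_ge0// ?powR_ge0 ?kern_ge0.
rewrite normrM (ger0_norm (kern_ge0 _ _ _ _)).
have [taul|taul] := leP tau (t / 2).
  rewrite ler_wpDr ?mulr_ge0 ?kern_ge0// mulrA ler_wpM2r//.
  by apply: kern_le1_far; rewrite ?(ltW s1)//; lra.
rewrite ler_wpDl ?mulr_ge0 ?powR_ge0 ?kern_ge0//.
have [/[dup] taut /andP[tau0 ltt]|taut] := boolP (0 < tau < t); last first.
  by rewrite !kern_out// mulr0 mul0r.
by rewrite mulrC ler_wpM2r ?kern_ge0// hM// ltW//= ltW.
Qed.

Section composition.
Variables (rho a b : R) (h : R -> R) (t : R).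
Hypotheses (rho0 : 0 < rho) (a01 : 0 < a <= 1) (b01 : 0 < b <= 1).
Hypotheses (hh : locally_summable rho h) (t0 : 0 < t).

Let F (p : R * R) : \bar R :=
  (kern rho a t p.1 * (kern rho b p.1 p.2 * h p.2))%:E.

Let mF : measurable_fun setT F.
Proof.
apply/measurable_EFinP; apply: measurable_funM.
  by apply: measurableT_comp; [exact: measurable_kernr|exact: measurable_fst].
under eq_fun do rewrite kern_patch.
apply: measurable_funM; first exact: measurable_kern2.
apply: measurableT_comp; last exact: measurable_snd.
by apply: measurable_pos_continuous; case: hh.
Qed.

Let ab0 : 0 < a + b.
Proof. by move/andP: a01 => [? _]; move/andP: b01 => [? _]; rewrite addr_gt0. Qed.

Let innerE (g : R -> R) y :
  (\int[mu]_x (kern rho a t x * (kern rho b x y * g y))%:E =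
   (beta a b / rho)%:E * (kern rho (a + b) t y * g y)%:E)%E.
Proof.
have kE : (\int[mu]_x (kern rho a t x * kern rho b x y)%:E =
   (kern rho (a + b) t y / rho * beta a b)%:E)%E.
  by rewrite kern_comp// BetaE// -EFinM.
have ik : mu.-integrable setT (fun x => (kern rho a t x * kern rho b x y)%:E).
  apply/integrableP; split.
    apply/measurable_EFinP; apply: measurable_funM; first exact: measurable_kernr.
    exact: measurable_kernl.
  rewrite [X in (X < _)%E](_ : _ =
    \int[mu]_x (kern rho a t x * kern rho b x y)%:E)%E; first by rewrite kE ltry.
  by apply: eq_integral => x _; rewrite abse_EFin ger0_norm// mulr_ge0// kern_ge0.
transitivity (\int[mu]_x ((g y)%:E * (kern rho a t x * kern rho b x y)%:E))%E.
  by apply: eq_integral => x _; rewrite -EFinM mulrA mulrC.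
rewrite (integralZl _ ik)// kE -!EFinM; congr (_%:E).
move: (kern _ _ _ _) (beta a b) (g y) => k B z.
by field; rewrite gt_eqF.
Qed.

Let iF : (lebesgue_measure \x lebesgue_measure)%E.-integrable setT F.
Proof.
apply: (proj2 (integrable21ltyP lebesgue_measure lebesgue_measure mF)).
rewrite [X in (X < _)%E](_ : _ = \int[mu]_y ((beta a b / rho)%:E *
    (kern rho (a + b) t y * `|h y|)%:E))%E; last first.
  apply: eq_integral => y _; rewrite -(@innerE (fun y => `|h y|)).
  apply: eq_integral => x _; rewrite /F abse_EFin /=.
  by rewrite 2!normrM (ger0_norm (kern_ge0 rho a t x)) (ger0_norm (kern_ge0 rho b x y)).
have /integrableP[_] := @integrableZl _ _ _ mu _ measurableT (beta a b / rho) _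
  (locally_summable_integrable rho0 hh ab0 t0).
apply: le_lt_trans; rewrite le_eqVlt; apply/orP; left; apply/eqP.
apply: eq_integral => y _; rewrite -!EFinM abse_EFin (normrM (beta a b / rho)) (normrM (beta a b)) (normrM (kern _ _ _ _)); congr (_%:E).
rewrite (ger0_norm (kern_ge0 rho (a + b) t y)) (ger0_norm (ltW (beta_gt0 a01 b01))).
by rewrite gtr0_norm// invr_gt0.
Qed.

Let innerF x : (\int[mu]_y F (x, y) = (kern rho a t x * abel rho b h x)%:E)%E.
Proof.
have [/andP[x0 xt]|xt] := boolP (0 < x < t); last first.
  by rewrite integral0_eq ?kern_out ?mul0r// => y _; rewrite /F kern_out// mul0r.
have b0 : 0 < b by case/andP: b01.
have ib := locally_summable_integrable rho0 hh b0 x0.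
transitivity ((kern rho a t x)%:E * \int[mu]_y (kern rho b x y * h y)%:E)%E.
  rewrite -(integralZl measurableT ib).
  by apply: eq_integral => y _; rewrite -EFinM /F /=.
by rewrite EFinM; congr (_ * _)%E; rewrite /abel /Rintegral fineK//; exact: integrable_fin_num.
Qed.

(** Fubini's theorem for the triangle 0 < y < x < t. *)
Lemma abel_comp :
  abel_integrable rho a (abel rho b h) t /\
  abel rho a (abel rho b h) t = beta a b / rho * abel rho (a + b) h t.
Proof.
have iab := locally_summable_integrable rho0 hh ab0 t0.
split.
  have := integrable_fubini_F iF.
  by apply: eq_integrable => // x _; rewrite /fubini_F innerF.
apply: EFin_inj.
transitivity (\int[mu]_x \int[mu]_y F (x, y))%E.
  rewrite /abel /Rintegral fineK.
    by apply: eq_integral => x _; rewrite innerF.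
  apply: integrable_fin_num => //.
  have := integrable_fubini_F iF.
  by apply: eq_integrable => // x _; rewrite /fubini_F innerF.
rewrite (Fubini iF) EFinM /abel /Rintegral fineK; last exact: integrable_fin_num.
rewrite -(integralZl measurableT iab); apply: eq_integral => y _.
by rewrite -(@innerE h).
Qed.
End composition.
End abel_semigroup.

(** * Continuity of fractional integrals *)

Section abel_continuous.
Context {R : realType}.
Notation mu := (@lebesgue_measure R).
Implicit Types (a b r s t tau rho sigma : R) (h : R -> R).

(** The mass of the kernel close to its singularity. *)
Lemma kern_tail rho s l t : 0 < rho -> 0 < s <= 1 -> 0 <= l -> l < t ->
  \int[mu]_tau (if l < tau then kern rho s t tau else 0) =
  beta s 1 / rho * (t `^ rho - l `^ rho) `^ s.
Proof.
move=> rho0 s01 l0 lt.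
have := beta_integral s 1 rho0 l0 lt.
rewrite BetaE ?ltr01 ?lexx// addrK -EFinM => E.
suff IE : (\int[mu]_tau (if l < tau then kern rho s t tau else 0)%:E =
    ((t `^ rho - l `^ rho) `^ s / rho * beta s 1)%:E)%E.
  by rewrite /Rintegral IE/= mulrC mulrA mulrAC.
rewrite -E.
rewrite [RHS]integral_mkcond; apply: eq_integral => r _.
rewrite patchE; have [lr|rl] := ltP l r; case: ifPn; rewrite ?inE ?notin_setE/= in_itv/=.
- move=> /andP[_ rt]; have rt' : 0 < r < t by rewrite (le_lt_trans l0 lr).
  by rewrite (kernE _ _ rt') (subrr 1) powRr0 mulr1.
- by rewrite lr/= => /negP rt; rewrite kern_out// negb_and rt orbT.
- by rewrite ltNge rl.
- by [].
Qed.

(** A bounded continuous substitute for z^(s - 1): equal to it from eps on,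
    linear on [0, eps], zero for negative z. *)
Definition cutoff s eps z : R :=
  (Num.max z eps) `^ (s - 1) * Num.max 0 (Num.min (z / eps) 1).

Section cutoff.
Variables (s eps : R).
Hypotheses (s1 : s <= 1) (eps0 : 0 < eps).

Lemma continuous_cutoff z : {for z, continuous (cutoff s eps)}.
Proof.
apply: for_continuousM.
  apply: for_continuous_powR; last by rewrite lt_max eps0 orbT.
  by apply: continuous_max; [move=> ?|exact: cst_continuous].
apply: continuous_max; first exact: cst_continuous.
apply: continuous_min; last exact: cst_continuous.
by apply: for_continuousM; [move=> ?|exact: cst_continuous].
Qed.

Lemma cutoff_ge0 z : 0 <= cutoff s eps z.
Proof. by rewrite mulr_ge0 ?powR_ge0// le_max lexx. Qed.

Lemma cutoff_le z : cutoff s eps z <= eps `^ (s - 1).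
Proof.
rewrite /cutoff -[leRHS]mulr1 ler_pM ?powR_ge0// ?le_max ?lexx//.
  apply: ler_powR_neg => //; first by rewrite subr_le0.
  by rewrite le_max lexx orbT.
by rewrite ge_max ler01 ge_min lexx orbT.
Qed.

Lemma cutoff_npos z : z <= 0 -> cutoff s eps z = 0.
Proof.
move=> z0; rewrite /cutoff (_ : Num.max 0 _ = 0) ?mulr0//.
by apply/max_idPl; rewrite ge_min pmulr_lle0 ?invr_gt0// z0.
Qed.

Lemma cutoff_id z : eps <= z -> cutoff s eps z = z `^ (s - 1).
Proof.
move=> ez; rewrite /cutoff (max_idPl ez) (min_idPr _) ?(max_idPr _) ?mulr1//.
by rewrite ler_pdivlMr// mul1r.
Qed.

Lemma cutoff_le_powR z : 0 < z -> cutoff s eps z <= z `^ (s - 1).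
Proof.
move=> z0; rewrite /cutoff -[leRHS]mulr1 ler_pM ?powR_ge0// ?le_max ?lexx//.
  apply: ler_powR_neg => //; first by rewrite subr_le0.
  by rewrite le_max lexx.
by rewrite ge_max ler01 ge_min lexx orbT.
Qed.
End cutoff.

(** With the cut-off kernel the integral is continuous by dominated convergence.
    The error made by the cut-off at t is the integral of h against the part of
    the kernel where t^rho - tau^rho < eps, hence at most a constant times eps^s,
    uniformly for t near t0, since h is bounded away from 0. *)
Lemma abel_continuous rho s h : 0 < rho -> 0 < s <= 1 ->
  locally_summable rho h -> pos_continuous (abel rho s h).
Proof.
move=> rho0 s01 hh t0 t00; have /andP[s0 s1] := s01; have [ch ih] := hh.
pose T := 2 * t0; have t0T : t0 < T by rewrite /T; lra.
have T0 : 0 < T by exact: lt_trans t0T.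
pose u := t0 / 2; have u0 : 0 < u by rewrite divr_gt0.
have ut0 : u < t0 by rewrite /u; lra.
(* If t > u and t^rho - tau^rho < eps0, then tau > l0. *)
pose eps0 := u `^ rho / 2; have eps00 : 0 < eps0 by rewrite divr_gt0 ?powR_gt0.
pose l0 := eps0 `^ rho^-1; have l00 : 0 < l0 by rewrite powR_gt0.
have [M M0 hM] := @pos_continuous_bounded R h l0 T ch l00.
pose C := M * (beta s 1 / rho).
have B0 : 0 < beta s 1 by apply: beta_gt0 => //; rewrite ltr01 lexx.
have C0 : 0 <= C by rewrite mulr_ge0// divr_ge0// ltW.
apply: continuous_uniform_approx => e e0.
pose eps := Num.min eps0 ((e / (C + 1)) `^ s^-1).
have C1 : 0 < C + 1 by rewrite ltr_wpDl.
have eC : 0 < e / (C + 1) by rewrite divr_gt0.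
have epsgt0 : 0 < eps by rewrite lt_min eps00 powR_gt0.
have epsle : eps <= eps0 by rewrite ge_min lexx.
have epss : C * eps `^ s <= e.
  apply: (@le_trans _ _ (C * (e / (C + 1)))).
    apply: ler_wpM2l => //; rewrite -[leRHS](powR_root s0 (ltW eC)).
    apply: ge0_ler_powR; rewrite ?nnegrE ?powR_ge0 ?(ltW s0) ?(ltW epsgt0)//.
    by rewrite ge_min lexx orbT.
  rewrite mulrA ler_pdivrMr// mulrC ler_wpM2l ?(ltW e0)//; lra.
(* The factor of order 1 does not depend on t and dominates as soon as t < T. *)
pose f t tau := kern rho 1 T tau * h tau * cutoff s eps (t `^ rho - tau `^ rho).
pose G t := \int[mu]_tau f t tau.
have mf t : measurable_fun setT (f t).
  apply: measurable_funM; first exact: measurable_kernM.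
  apply: (@measurableT_comp _ _ _ _ _ _ (cutoff s eps)).
    by apply: continuous_measurable_fun => z; exact: continuous_cutoff.
  by apply: measurable_funB => //; exact: measurable_powR_comp.
have dom t tau : `|f t tau| <= eps `^ (s - 1) * `|kern rho 1 T tau * h tau|.
  rewrite /f normrM mulrC ler_wpM2r// ger0_norm ?cutoff_ge0//.
  exact: cutoff_le.
have idom : mu.-integrable setT (EFin \o (fun tau => eps `^ (s - 1) * `|kern rho 1 T tau * h tau|)).
  exact: (@integrableZl _ _ _ mu _ measurableT (eps `^ (s - 1)) _ (integrable_abse (ih _ T0))).
have if_ t : mu.-integrable setT (EFin \o f t).
  apply: le_integrable idom => //; first by apply/measurable_EFinP; exact: mf.
  move=> tau _; rewrite /= lee_fin (le_trans (dom t tau))//.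
  by rewrite ler_norm.
have cf tau t : 0 < t -> {for t, continuous (f ^~ tau)}.
  move=> t_gt0; apply: for_continuousM; first exact: cst_continuous.
  apply: (@continuous_comp _ _ _ (fun t => t `^ rho - tau `^ rho) (cutoff s eps)).
    by apply: for_continuousB; [exact: continuous_powR|exact: cst_continuous].
  exact: continuous_cutoff.
exists G; split.
  have : {in `]u, T[%classic, continuous G}.
    apply: (@continuity_under_integral R _ _ mu f setT measurableT u T _ _ _ idom).
    - by move=> t _; exact: if_.
    - apply: aeW => tau _ t; rewrite inE/= in_itv/= => /andP[ut _].
      by apply: cf; exact: lt_trans ut.
    - by move=> t _; apply: aeW => tau _; exact: dom.
  by apply; rewrite inE/= in_itv/= ut0.
near=> t.
have ut : u < t by near: t; exact: lt_nbhsr.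
have tT : t < T by near: t; exact: lt_nbhsl.
have tt0 : 0 < t by exact: lt_trans ut.
have ueps : eps < t `^ rho - eps0.
  have : u `^ rho < t `^ rho by apply: ltr_powR => //; exact: ltW.
  by move: epsle; rewrite /eps0; lra.
pose l := (t `^ rho - eps) `^ rho^-1.
have lE : l `^ rho = t `^ rho - eps.
  by rewrite powR_root// subr_ge0; lra.
have l00' : 0 <= l by exact: powR_ge0.
have lt : l < t.
  rewrite -[X in _ < X](powRK rho0 (ltW tt0)); apply: ltr_powR.
  - by rewrite invr_gt0.
  - by rewrite subr_ge0; lra.
  - by rewrite ltrBlDr ltrDl.
have l0l : l0 <= l.
  apply: ge0_ler_powR; rewrite ?nnegrE ?invr_ge0 ?(ltW rho0) ?(ltW eps00)//; last lra.
  by rewrite subr_ge0; lra.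
have q_int : mu.-integrable setT (EFin \o (fun tau => if l < tau then kern rho s t tau else 0)).
  apply: le_integrable (kern_integrable rho0 s01 tt0) => //.
    apply/measurable_EFinP; apply: measurable_fun_ifT => //.
      exact: measurable_fun_ltr.
    exact: measurable_kernr.
  move=> tau _; rewrite /= lee_fin; case: ifP => // _.
  by rewrite normr0.
have iabel : abel_integrable rho s h t by exact: locally_summable_integrable.
rewrite /abel /G -RintegralB//.
apply: (le_trans (le_normr_Rintegral _ _)) => //.
  exact: (integrableB measurableT iabel (if_ t)).
apply: (@le_trans _ _ (M * \int[mu]_tau (if l < tau then kern rho s t tau else 0))).
  rewrite -RintegralZl//; apply: le_Rintegral => //.
  - exact: (integrable_abse (integrableB measurableT iabel (if_ t))).
  - exact: (@integrableZl _ _ _ mu _ measurableT M _ q_int).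
  move=> tau _; rewrite /f.
  have q0 : 0 <= (if l < tau then kern rho s t tau else 0).
    by case: ifP => // _; exact: kern_ge0.
  have [/[dup] taut /andP[tau0 taultt]|taut] := boolP (0 < tau < t); last first.
    rewrite (kern_out _ _ taut) mul0r sub0r normrN.
    suff -> : kern rho 1 T tau * h tau * cutoff s eps (t `^ rho - tau `^ rho) = 0.
      by rewrite normr0 mulr_ge0//; case: ifP.
    move: taut; rewrite negb_and -!leNgt => /orP[tau0|ttau].
      by rewrite kern_out ?mul0r// negb_and -leNgt tau0.
    rewrite cutoff_npos ?mulr0// subr_le0.
    apply: ge0_ler_powR; rewrite ?nnegrE ?(ltW rho0) ?(ltW tt0)//.
    by rewrite (le_trans (ltW tt0)).
  have tauT : 0 < tau < T by rewrite tau0 (lt_trans taultt).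
  set z := t `^ rho - tau `^ rho.
  have z0 : 0 < z by rewrite subr_gt0; apply: ltr_powR => //; exact: ltW.
  have -> : kern rho s t tau * h tau - kern rho 1 T tau * h tau * cutoff s eps z =
      tau `^ (rho - 1) * h tau * (z `^ (s - 1) - cutoff s eps z).
    rewrite (kernE _ _ taut) (kernE _ _ tauT) (subrr 1) powRr0 mulr1 -/z.
    by move: (tau `^ _) (z `^ _) (cutoff _ _ _) (h tau) => p q r v; ring.
  have [ltau|taul] := ltP l tau; last first.
    suff -> : cutoff s eps z = z `^ (s - 1) by rewrite subrr mulr0 normr0 mulr0.
    apply: cutoff_id => //; rewrite /z lerBrDr -lerBrDl -lE.
    by apply: ge0_ler_powR; rewrite ?nnegrE ?(ltW rho0) ?(ltW tau0).
  rewrite (kernE _ _ taut) -/z.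
  have cz := cutoff_le_powR eps s1 z0; have cz0 := cutoff_ge0 s eps z.
  rewrite normrM normrM (ger0_norm (powR_ge0 _ _)).
  rewrite [X in _ * X]ger0_norm ?subr_ge0// mulrAC mulrC.
  apply: ler_pM => //.
  - by rewrite mulr_ge0 ?powR_ge0 ?subr_ge0.
  - by apply: hM; rewrite (le_trans l0l (ltW ltau)) (ltW (lt_trans taultt _)).
  - by apply: ler_wpM2l; [exact: powR_ge0|rewrite gerBl].
rewrite kern_tail// lE opprB addrCA subrr addr0 mulrA.
exact: epss.
Unshelve. all: by end_near. Qed.
End abel_continuous.

(** * Estimates, and the normalisation of Katugampola *)

Section katugampola.
Context {R : realType}.
Notation mu := (@lebesgue_measure R).
Implicit Types (a b r s t tau rho sigma : R) (h k : R -> R).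

Lemma abel_locally_summable rho s h : 0 < rho -> 0 < s <= 1 ->
  locally_summable rho h -> locally_summable rho (abel rho s h).
Proof.
move=> rho0 s01 hh; split; first exact: abel_continuous.
move=> t t0; have := @abel_comp R rho 1 s h t rho0.
by rewrite ltr01 lexx => /(_ isT s01 hh t0)[].
Qed.

Lemma eq_kernM rho s h k t : {in `]0, t[, h =1 k} ->
  (fun tau => kern rho s t tau * h tau) = (fun tau => kern rho s t tau * k tau).
Proof.
move=> hk; apply/funext => tau.
have [taut|taut] := boolP (0 < tau < t); last by rewrite kern_out// !mul0r.
by rewrite hk// in_itv.
Qed.

Lemma eq_abel rho s h k t : {in `]0, t[, h =1 k} ->
  abel rho s h t = abel rho s k t.
Proof. by move=> /(eq_kernM rho s) hk; rewrite /abel hk. Qed.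

Lemma eq_abel_integrable rho s h k t : {in `]0, t[, h =1 k} ->
  abel_integrable rho s h t -> abel_integrable rho s k t.
Proof.
by move=> /(eq_kernM rho s)/funeqP hk; rewrite /abel_integrable; under eq_fun do rewrite hk.
Qed.

Lemma abel_integrableD rho s h k t : abel_integrable rho s h t ->
  abel_integrable rho s k t -> abel_integrable rho s (fun tau => h tau + k tau) t.
Proof.
move=> ih ik; have := integrableD measurableT ih ik.
by apply: eq_integrable => // tau _; rewrite /= -EFinD mulrDr.
Qed.

Lemma abelD rho s h k t : abel_integrable rho s h t -> abel_integrable rho s k t ->
  abel rho s (fun tau => h tau + k tau) t = abel rho s h t + abel rho s k t.
Proof.
move=> ih ik; rewrite /abel -RintegralD//.
by apply: eq_Rintegral => tau _; rewrite mulrDr.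
Qed.

Lemma abel_integrableZ rho s h t c : abel_integrable rho s h t ->
  abel_integrable rho s (fun tau => c * h tau) t.
Proof.
move=> ih; have := @integrableZl _ _ _ mu _ measurableT c _ ih.
by apply: eq_integrable => // tau _; rewrite -EFinM mulrCA.
Qed.

Lemma abelZ rho s h t c : abel_integrable rho s h t ->
  abel rho s (fun tau => c * h tau) t = c * abel rho s h t.
Proof.
move=> ih; rewrite /abel -RintegralZl//.
by apply: eq_Rintegral => tau _; rewrite mulrCA.
Qed.

Lemma abel_integrable_norm rho s h t : abel_integrable rho s h t ->
  abel_integrable rho s (fun tau => `|h tau|) t.
Proof.
move=> /integrable_abse; apply: eq_integrable => // tau _.
by rewrite /= normrM ger0_norm// kern_ge0.
Qed.

Lemma le_abel rho s h k t : abel_integrable rho s h t -> abel_integrable rho s k t ->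
  {in `]0, t[, forall tau, h tau <= k tau} -> abel rho s h t <= abel rho s k t.
Proof.
move=> ih ik hk; apply: le_Rintegral => // tau _.
have [taut|taut] := boolP (0 < tau < t); last by rewrite kern_out// !mul0r.
by apply: ler_wpM2l; [exact: kern_ge0|apply: hk; rewrite in_itv].
Qed.

Lemma ler_norm_abel rho s h k t : abel_integrable rho s h t ->
  abel_integrable rho s k t -> {in `]0, t[, forall tau, `|h tau| <= k tau} ->
  `|abel rho s h t| <= abel rho s k t.
Proof.
move=> ih ik hk; apply: (@le_trans _ _ (abel rho s (fun tau => `|h tau|) t)).
  apply: (le_trans (le_normr_Rintegral _ _)) => //.
  rewrite le_eqVlt; apply/orP; left; apply/eqP; apply: eq_Rintegral => tau _.
  by rewrite normrM ger0_norm// kern_ge0.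
by apply: le_abel => //; exact: abel_integrable_norm.
Qed.

Lemma abel_integrable_power rho s b t : 0 < rho -> 0 < s <= 1 -> 0 < b <= 1 ->
  0 < t -> abel_integrable rho s (fun tau => tau `^ (rho * (b - 1))) t.
Proof.
move=> rho0 s01 b01 t0; apply: abel_integrableP.
  by move=> x; exact: continuous_powR.
have E := kern_power s b rho0 t0.
rewrite (_ : (fun tau => _) = (fun tau => (kern rho s t tau * tau `^ (rho * (b - 1)))%:E)).
  by rewrite E BetaE// -EFinM ltry.
by apply/funext => tau; rewrite ger0_norm// powR_ge0.
Qed.

Lemma abel_power rho s b t : 0 < rho -> 0 < s <= 1 -> 0 < b <= 1 -> 0 < t ->
  abel rho s (fun tau => tau `^ (rho * (b - 1))) t =
  beta s b / rho * t `^ (rho * (s + b - 1)).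
Proof.
move=> rho0 s01 b01 t0; rewrite /abel /Rintegral kern_power// BetaE//= -powRrM.
by rewrite mulrAC -mulrA mulrC.
Qed.

Lemma locally_summable_power rho b : 0 < rho -> 0 < b <= 1 ->
  locally_summable rho (fun t => t `^ (rho * (b - 1))).
Proof.
move=> rho0 b01; split; first by move=> x; exact: continuous_powR.
by move=> t t0; apply: abel_integrable_power => //; rewrite ltr01 lexx.
Qed.

Lemma le_locally_summable rho h k : pos_continuous h -> locally_summable rho k ->
  (forall t, 0 < t -> exists C, forall tau, 0 < tau < t -> `|h tau| <= C * `|k tau|) ->
  locally_summable rho h.
Proof.
move=> ch [ck ik] hk; split => // t t0; have [C hC] := hk _ t0.
have := @integrableZl _ _ _ mu _ measurableT C _ (ik _ t0).
apply: le_integrable => //.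
  by apply/measurable_EFinP; exact: measurable_kernM.
move=> tau _; rewrite /= lee_fin.
have [taut|taut] := boolP (0 < tau < t); last by rewrite kern_out// !mul0r normr0 mulr0 normr0.
rewrite !normrM mulrCA; apply: ler_wpM2l => //.
by apply: (le_trans (hC _ taut)); apply: ler_wpM2r => //; exact: ler_norm.
Qed.

Lemma katugampola_kern rho s h t tau :
  kern rho s t tau * h tau =
  ((katugampola_integrand rho s h t) \_ `]0, t[) tau.
Proof.
rewrite patchE; case: ifPn; rewrite ?inE ?notin_setE/= in_itv/=.
  move=> taut; rewrite (kernE _ _ taut) /katugampola_integrand -powRN opprB.
  by rewrite mulrAC.
by move=> /negP taut; rewrite kern_out// mul0r.
Qed.

Lemma katugampolaE rho s h t : s != 0 ->
  katugampola rho s h t = rho `^ (1 - s) / Gamma s * abel rho s h t.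
Proof.
move=> /negbTE s0; rewrite /katugampola s0; congr (_ * _).
rewrite Rintegral_mkcond; apply: eq_Rintegral => tau _.
by rewrite katugampola_kern.
Qed.

Lemma katugampola_integrableP rho s h t :
  abel_integrable rho s h t <-> mu.-integrable `]0, t[ (EFin \o katugampola_integrand rho s h t).
Proof.
apply: (iff_trans _ (iff_sym (integrable_mkcond _ _))); last exact: measurable_itv.
rewrite restrict_EFin /abel_integrable.
by under eq_fun do rewrite katugampola_kern.
Qed.
End katugampola.

(** * Semigroup law and fundamental theorem for Katugampola integrals *)

Section semigroup.
Context {R : realType}.
Notation mu := (@lebesgue_measure R).
Implicit Types (a b r s t tau rho sigma : R) (h k : R -> R).

Lemma katugampola0 rho h : katugampola rho 0 h = h.
Proof. by apply/funext => t; rewrite /katugampola eqxx. Qed.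

Lemma katugampola_funE rho s h : s != 0 ->
  katugampola rho s h = (fun t => rho `^ (1 - s) / Gamma s * abel rho s h t).
Proof. by move=> s0; apply/funext => t; rewrite katugampolaE. Qed.

Lemma eq_katugampola rho s h k t : 0 < t ->
  (forall tau, 0 < tau -> h tau = k tau) -> katugampola rho s h t = katugampola rho s k t.
Proof.
move=> t0 hk; have [->|s0] := eqVneq s 0; first by rewrite !katugampola0 hk.
rewrite !katugampolaE//; congr (_ * _); apply: eq_abel => tau.
by rewrite in_itv/= => /andP[tau0 _]; exact: hk.
Qed.

Lemma katugampola_definedP rho s h :
  katugampola_defined rho s h <-> s = 0 \/ forall t, 0 < t -> abel_integrable rho s h t.
Proof.
split=> -[->|ih]; [by left|right|by left|right] => t t0.
  by apply/katugampola_integrableP; exact: ih.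
by apply/katugampola_integrableP; exact: ih.
Qed.

Lemma eq_katugampola_defined rho s h k : (forall tau, 0 < tau -> h tau = k tau) ->
  katugampola_defined rho s h -> katugampola_defined rho s k.
Proof.
move=> hk /katugampola_definedP[s0|ih]; apply/katugampola_definedP; first by left.
right=> t t0; apply: eq_abel_integrable (ih _ t0) => tau.
by rewrite in_itv/= => /andP[tau0 _]; exact: hk.
Qed.

Lemma locally_summable_defined rho s h : 0 < rho -> 0 <= s ->
  locally_summable rho h -> katugampola_defined rho s h.
Proof.
move=> rho0; rewrite le_eqVlt => /predU1P[<-|s0] hh; apply/katugampola_definedP.
  by left.
by right=> t; exact: locally_summable_integrable.
Qed.

Lemma locally_summableZ rho h c : locally_summable rho h ->
  locally_summable rho (fun t => c * h t).
Proof.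
move=> [ch ih]; split; last by move=> t t0; apply: abel_integrableZ; exact: ih.
by move=> t t0; apply: for_continuousM; [exact: cst_continuous|exact: ch].
Qed.

Lemma katugampola_locally_summable rho s h : 0 < rho -> 0 <= s <= 1 ->
  locally_summable rho h -> locally_summable rho (katugampola rho s h).
Proof.
move=> rho0 /andP[]; rewrite le_eqVlt => /predU1P[<-|s0 s1] hh.
  by rewrite katugampola0.
rewrite katugampola_funE ?gt_eqF//; apply: locally_summableZ.
by apply: abel_locally_summable => //; rewrite s0.
Qed.

Lemma katugampolaZ rho s h t c : 0 < rho -> 0 <= s -> locally_summable rho h ->
  0 < t -> katugampola rho s (fun tau => c * h tau) t = c * katugampola rho s h t.
Proof.
move=> rho0; rewrite le_eqVlt => /predU1P[<-|s0] hh t0; first by rewrite !katugampola0.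
rewrite !katugampolaE ?gt_eqF// abelZ; first by rewrite mulrCA.
exact: locally_summable_integrable.
Qed.

Lemma katugampolaD rho s h k t : 0 < rho -> 0 <= s -> locally_summable rho h ->
  locally_summable rho k -> 0 < t ->
  katugampola rho s (fun tau => h tau + k tau) t =
  katugampola rho s h t + katugampola rho s k t.
Proof.
move=> rho0; rewrite le_eqVlt => /predU1P[<-|s0] hh kk t0; first by rewrite !katugampola0.
by rewrite !katugampolaE ?gt_eqF// abelD -?mulrDr//; exact: locally_summable_integrable.
Qed.

(** The constants match because Gamma(a) Gamma(b) = Gamma(a + b) B(a, b). *)
Lemma katugampola_comp rho a b h t : 0 < rho -> 0 <= a -> 0 <= b -> a + b <= 1 ->
  locally_summable rho h -> 0 < t ->
  katugampola rho a (katugampola rho b h) t = katugampola rho (a + b) h t.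
Proof.
move=> rho0; rewrite le_eqVlt => /predU1P[<-|a0].
  by rewrite add0r => *; rewrite katugampola0.
rewrite le_eqVlt => /predU1P[<-|b0]; first by rewrite addr0 => *; rewrite katugampola0.
move=> ab1 hh t0.
have a01 : 0 < a <= 1 by rewrite a0; lra.
have b01 : 0 < b <= 1 by rewrite b0; lra.
have ab01 : 0 < a + b <= 1 by rewrite addr_gt0.
have bh := abel_locally_summable rho0 b01 hh.
rewrite (katugampola_funE _ _ (lt0r_neq0 b0)) katugampolaZ ?(ltW a0)//.
rewrite !katugampolaE ?gt_eqF ?addr_gt0//.
have [_ ->] := abel_comp rho0 a01 b01 hh t0.
have Ga := Gamma_gt0 a01; have Gb := Gamma_gt0 b01; have Gab := Gamma_gt0 ab01.
have := GammaM a01 b01; have := beta_gt0 a01 b01.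
have -> : rho `^ (1 - b) = rho `^ (1 - (a + b)) * rho `^ a.
  by rewrite -powRD_gt0//; congr (_ `^ _); ring.
have -> : rho `^ (1 - a) = rho / rho `^ a.
  by rewrite powRD_gt0// powRr1 ?ltW// powRN.
have : 0 < rho `^ a by exact: powR_gt0.
move: (Gamma a) (Gamma b) (Gamma (a + b)) Ga Gb Gab => x y z x0 y0 z0.
move: (rho `^ a) (rho `^ _) (beta a b) (abel _ _ _ _) => p q B J p0 B0 GE.
have -> : B = x * y / z by rewrite GE mulrC mulKf// gt_eqF.
by field; rewrite !gt_eqF.
Qed.

Lemma Gamma1D_neq0 s : 0 < s <= 1 -> Gamma (1 + s) != 0.
Proof.
move=> s01; have [+ _] := @eGamma_Beta_fin R 1 s (introT andP (conj ltr01 (lexx 1))) s01.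
by move=> fin; rewrite GammaE -eqe fineK// gt_eqF// eGamma_gt0.
Qed.

Lemma beta1C s : 0 < s <= 1 -> beta s 1 = beta 1 s.
Proof.
move=> s01; apply: (mulfI (Gamma1D_neq0 s01)).
have i1 : 0 < (1 : R) <= 1 by rewrite ltr01 lexx.
have := GammaM s01 i1; rewrite (addrC s 1) => E.
exact: (etrans (esym E) (etrans (mulrC _ _) (GammaM i1 s01))).
Qed.

(** The case of total order 1 + s > 1, where the two compositions are only
    compared with each other. *)
Lemma katugampola_comm1 rho s h t : 0 < rho -> 0 <= s <= 1 ->
  locally_summable rho h -> 0 < t ->
  katugampola rho s (katugampola rho 1 h) t = katugampola rho 1 (katugampola rho s h) t.
Proof.
move=> rho0 /andP[]; rewrite le_eqVlt => /predU1P[<-|s0 s1] hh t0.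
  by rewrite !katugampola0.
have s01 : 0 < s <= 1 by rewrite s0.
have i1 : 0 < (1 : R) <= 1 by rewrite ltr01 lexx.
rewrite (katugampola_funE rho h (lt0r_neq0 s0)) (katugampola_funE rho h (oner_neq0 R)).
have L1 := abel_locally_summable rho0 i1 hh.
have Ls := abel_locally_summable rho0 s01 hh.
rewrite (katugampolaZ _ rho0 (ltW s0) L1 t0) (katugampolaZ _ rho0 ler01 Ls t0).
rewrite (katugampolaE _ _ _ (lt0r_neq0 s0)) (katugampolaE _ _ _ (oner_neq0 R)).
have [_ ->] := abel_comp rho0 s01 i1 hh t0.
have [_ ->] := abel_comp rho0 i1 s01 hh t0.
rewrite (addrC s 1) (beta1C s01).
by move: (rho `^ _ / _) (rho `^ _ / _) => p q; rewrite mulrCA.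
Qed.

Lemma kern1E rho u tau : 0 < tau < u -> kern rho 1 u tau = tau `^ (rho - 1).
Proof. by move=> tauu; rewrite (kernE _ _ tauu) (subrr 1) powRr0 mulr1. Qed.

Lemma abel_integrable1P rho h t : abel_integrable rho 1 h t <->
  mu.-integrable `]0, t[ (EFin \o (fun tau => tau `^ (rho - 1) * h tau)).
Proof.
apply: (iff_trans (katugampola_integrableP _ _ _ _)).
have E : {in `]0, t[%classic, EFin \o katugampola_integrand rho 1 h t =1
    EFin \o (fun tau => tau `^ (rho - 1) * h tau)}.
  by move=> tau _ /=; rewrite /katugampola_integrand (subrr 1) powRr0 divr1.
split; first by apply: eq_integrable => //; exact: E.
by apply: eq_integrable => // tau taut; rewrite E.
Qed.

Lemma katugampola1_integral rho h t : locally_summable rho h -> 0 < t ->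
  katugampola rho 1 h t = \int[mu]_(tau in `]0, t]) (tau `^ (rho - 1) * h tau).
Proof.
move=> [ch ih] t0; rewrite -Rintegral_itv_bndo_bndc; last first.
  by apply/abel_integrable1P; exact: ih.
rewrite /katugampola oner_eq0 subrr powRr0 Gamma1 divr1 mul1r.
apply: eq_Rintegral => tau _.
by rewrite /katugampola_integrand (subrr 1) powRr0 divr1.
Qed.

(** The integral of order 1 is the primitive of tau^(rho - 1) h(tau), and delta
    divides its derivative by t^(rho - 1). *)
Lemma katugampola1_derive rho h t : locally_summable rho h -> 0 < t ->
  derivable (katugampola rho 1 h) t 1 /\ delta rho (katugampola rho 1 h) t = h t.
Proof.
move=> hh t0; have [ch ih] := hh.
pose g tau := tau `^ (rho - 1) * h tau.
pose F y := \int[mu]_(tau in `]0, y]) g tau.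
have ig : mu.-integrable `]0, t + 1] (EFin \o g).
  have ig2 : mu.-integrable `]0, t + 2[ (EFin \o g).
    by apply/abel_integrable1P; apply: ih; rewrite addr_gt0.
  apply: integrableS ig2 => //.
  by move=> x /=; rewrite !in_itv/= => /andP[-> x1]; rewrite (le_lt_trans x1)//; lra.
have cg : {for t, continuous g}.
  by apply: for_continuousM; [exact: continuous_powR|exact: ch].
have tt1 : t < t + 1 by rewrite ltrDl.
have [dF F'] := @continuous_FTC1 R g (BRight 0) t (t + 1) tt1 ig t0 cg.
have nearE : {near t, katugampola rho 1 h =1 F}.
  near=> y; apply: katugampola1_integral => //.
  by near: y; exact: lt_nbhsr.
split.
  apply: near_eq_derivable dF.
  by near=> y; rewrite (near nearE y).
rewrite /delta derive1E (near_eq_derive _ nearE) -derive1E F' /g.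
rewrite mulrA -powRD_gt0//.
by rewrite (_ : 1 - rho + (rho - 1) = 0) ?powRr0 ?mul1r//; ring.
Unshelve. all: by end_near. Qed.

Lemma katugampola_power rho g t : 0 < rho -> 0 < g <= 1 -> 0 < t ->
  katugampola rho (1 - g) (fun tau => (tau `^ rho / rho) `^ (g - 1)) t = Gamma g.
Proof.
move=> rho0 g01 t0; have [g0 g1] := andP g01.
have [->|gn1] := eqVneq g 1; first by rewrite (subrr 1) katugampola0 powRr0 Gamma1.
have g1' : 0 < 1 - g by rewrite subr_gt0 lt_neqAle gn1.
have g101 : 0 < 1 - g <= 1 by rewrite g1'; lra.
rewrite (_ : (fun tau => _) = (fun tau => rho `^ (1 - g) * tau `^ (rho * (g - 1)))); last first.
  by apply/funext => tau; exact: powR_weight.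
rewrite katugampolaZ ?(ltW g1')//; last exact: locally_summable_power.
rewrite katugampolaE ?gt_eqF// abel_power// subrK (subrr 1) mulr0 powRr0 mulr1.
have := GammaM g101 g01; rewrite subrK Gamma1 mul1r => <-.
move: (Gamma g) (Gamma (1 - g)) (Gamma_gt0 g01) (Gamma_gt0 g101) => x y x0 y0.
have -> : rho `^ (1 - (1 - g)) = rho / rho `^ (1 - g).
  by rewrite powRD_gt0// powRr1 ?ltW// powRN.
have : 0 < rho `^ (1 - g) by exact: powR_gt0.
by move: (rho `^ (1 - g)) => p p0; field; rewrite !gt_eqF.
Qed.
End semigroup.

(** * Sequences with geometrically small steps *)

Section halving.
Context {R : realType}.
Implicit Types (u : nat -> R) (c e z : R).

Lemma half_exp_small c e : 0 < e -> exists n, c * 2^-1 ^+ n <= e.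
Proof.
move=> e0.
have h : `|2^-1 : R| < 1 by rewrite gtr0_norm ?invr_gt0//; lra.
have /cvgrPdist_le/(_ e e0)[n _ hn] : c * (2^-1 : R) ^+ n @[n --> \oo] --> c * 0.
  by apply: cvgM; [exact: cvg_cst|exact: cvg_expr].
exists n; have := hn n (leqnn n); rewrite /= mulr0 sub0r normrN.
by apply: le_trans; exact: ler_norm.
Qed.

Lemma half_exp_eq0 c z : (forall n, `|z| <= c * 2^-1 ^+ n) -> z = 0.
Proof.
move=> hz; apply/eqP; rewrite -normr_le0; apply/ler_addgt0Pl => e e0.
by have [n hn] := half_exp_small c e0; rewrite addr0; exact: le_trans hn.
Qed.

(** The intervals [u n - 2 c / 2^n, u n + 2 c / 2^n] are nested; the limit is the
    point that they share. *)
Lemma half_exp_lim u c : (forall n, `|u n.+1 - u n| <= c * 2^-1 ^+ n) ->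
  forall n, `|limn u - u n| <= 2 * c * 2^-1 ^+ n.
Proof.
move=> hu.
pose a n := u n - 2 * c * 2^-1 ^+ n; pose b n := u n + 2 * c * 2^-1 ^+ n.
have c0 n : 0 <= c * 2^-1 ^+ n by exact: le_trans (hu n).
have bd n : a n <= a n.+1 /\ b n.+1 <= b n.
  have := hu n; rewrite ler_norml /a /b exprS => /andP[].
  by move: (_ ^+ n) => q; split; lra.
have mona m n : (m <= n)%N -> a m <= a n.
  by move=> /subnK <-; elim: (n - m)%N => [|k IH]//; rewrite addSn (le_trans IH)//; have [] := bd (k + m)%N.
have monb m n : (m <= n)%N -> b n <= b m.
  by move=> /subnK <-; elim: (n - m)%N => [|k IH]//; rewrite addSn (le_trans _ IH)//; have [] := bd (k + m)%N.
have ab n : a n <= b n by rewrite /a /b; have := c0 n; move: (_ ^+ n) => q; lra.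
have amb m n : a m <= b n.
  rewrite (le_trans (mona m (maxn m n) (leq_maxl _ _)))// (le_trans (ab _))//.
  exact: monb (leq_maxr _ _).
pose l := sup (range a).
have hsup : has_sup (range a).
  by split; [exists (a 0%N); exists 0%N|exists (b 0%N) => _ [n _ <-]].
have la n : a n <= l by apply: ub_le_sup; [case: hsup|exists n].
have lb n : l <= b n by apply: ge_sup; [case: hsup|move=> _ [m _ <-]].
have hl n : `|l - u n| <= 2 * c * 2^-1 ^+ n.
  rewrite ler_norml; have := la n; have := lb n; rewrite /a /b.
  by move: (_ ^+ n) => q; lra.
suff -> : limn u = l by [].
apply/cvg_lim => //; apply/cvgrPdist_le => e e0.
have [n hn] := half_exp_small (2 * c) e0.
exists n => // m /= nm; apply: le_trans hn; apply: (le_trans (hl m)).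
have c00 : 0 <= c by have := c0 0%N; rewrite expr0 mulr1.
apply: ler_wpM2l; first by rewrite mulr_ge0.
by apply: ler_wiXn2l => //; lra.
Qed.
End halving.

(** * Auxiliary facts for the iteration *)

Section picard.
Context {R : realType}.
Notation mu := (@lebesgue_measure R).
Implicit Types (a b r s t tau : R) (h k x y : R -> R).

(** z^p <= 1 + z <= exp z for p in [0, 1]. *)
Lemma expRN_le_powR (z p : R) : 0 < z -> 0 <= p <= 1 -> expR (- z) <= z `^ (- p).
Proof.
move=> z0 /andP[p0 p1]; rewrite expRN powRN lef_pV2 ?posrE ?expR_gt0 ?powR_gt0//.
apply: (le_trans _ (expR_ge1Dx z)).
have [z1|z1] := leP z 1.
  apply: (@le_trans _ _ 1); last by rewrite lerDl ltW.
  by rewrite -[leRHS](powRr0 z); apply: ger_powR => //; rewrite z0.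
apply: (@le_trans _ _ z); last by rewrite lerDr.
by apply: ler1_powR => //; exact: ltW.
Qed.

Lemma pos_continuous2 (phi : R -> R -> R) x :
  {within [set p : R * R | 0 < p.1], continuous (fun p : R * R => phi p.1 p.2)} ->
  pos_continuous x -> pos_continuous (fun t => phi t (x t)).
Proof.
move=> hphi cx t t0.
have oA : open [set p : R * R | 0 < p.1].
  rewrite (_ : [set p : R * R | 0 < p.1] = fst @^-1` [set r : R | 0 < r])//.
  apply: open_comp; last exact: open_gt.
  by move=> p _; exact: cvg_fst.
move: hphi; rewrite (continuous_open_subspace _ oA) => /(_ (t, x t)).
rewrite inE/= => /(_ t0) cphi.
apply: (@continuous2_cvg R R R R (nbhs t) _ id x phi t (x t) cphi); first exact: cvg_id.
exact: cx.
Qed.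
End picard.

(** * Picard iteration for the Volterra equation *)

Section volterra.
Context {R : realType}.
Notation mu := (@lebesgue_measure R).
Variables (rho alpha gamma A kappa : R) (phi : R -> R -> R) (z0 : R -> R).
Hypotheses (rho0 : 0 < rho) (alpha01 : 0 < alpha <= 1) (gamma01 : 0 < gamma <= 1).
Hypotheses (A0 : 0 <= A) (kappa0 : 0 <= kappa).
Hypothesis cphi : {within [set p : R * R | 0 < p.1],
  continuous (fun p : R * R => phi p.1 p.2)}.
Hypothesis lip : forall t x y, 0 < t -> `|phi t x - phi t y| <= A * `|x - y|.
Hypothesis phi0 : forall S, 0 < S -> exists C, forall t, 0 < t <= S -> `|phi t 0| <= C.
Implicit Types (S t tau k : R) (h x y : R -> R).

Let pw tau : R := tau `^ (rho * (gamma - 1)).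

(** Boundedness of the weighted function near 0 stands in for the existence of
    its limit, which only the solution is shown to have. *)
Definition dominated_by_power h := pos_continuous h /\
  forall S, 0 < S -> exists2 C, 0 <= C & forall tau, 0 < tau <= S ->
    `|h tau| <= C * tau `^ (rho * (gamma - 1)).

Lemma dominated_summable h : dominated_by_power h -> locally_summable rho h.
Proof.
move=> [ch dh]; apply: (le_locally_summable ch (locally_summable_power rho0 gamma01)).
move=> t t0; have [C _ hC] := dh _ t0; exists C => tau /andP[tau0 taut].
by rewrite (ger0_norm (powR_ge0 _ _)); apply: hC; rewrite tau0 ltW.
Qed.

Let gm0 : rho * (gamma - 1) <= 0.
Proof. by move/andP: gamma01 => [_ g1]; rewrite pmulr_rle0// subr_le0. Qed.

(** A bounded function is also O(t^(rho (gamma - 1))) on (0, S], because the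
    exponent is not positive. *)
Lemma dominated_phi x : dominated_by_power x ->
  dominated_by_power (fun t => phi t (x t)).
Proof.
move=> [cx dx]; split; first exact: pos_continuous2.
move=> S S0; have [C C0 hC] := dx _ S0; have [P hP] := phi0 S0.
have P0 : 0 <= P by apply: le_trans (hP S _) => //; rewrite S0 lexx.
have pS0 : 0 < pw S by exact: powR_gt0.
exists (A * C + P / pw S).
  by apply: addr_ge0; [exact: mulr_ge0|apply: divr_ge0 => //; exact: ltW].
move=> tau tauS; have /andP[tau0 tS] := tauS.
rewrite -[phi _ _](subrK (phi tau 0)) (le_trans (ler_normD _ _))// mulrDl lerD//.
  rewrite (le_trans (lip _ _ tau0))// subr0 -mulrA; apply: ler_wpM2l => //.
  exact: hC.
rewrite (le_trans (hP _ tauS))// mulrAC ler_pdivlMr//.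
by apply: ler_wpM2l => //; exact: ler_powR_neg.
Qed.

(** Integration of order s improves the behaviour at 0 by the power rho s. *)
Lemma abel_power_bound s h S : 0 < s <= 1 -> dominated_by_power h -> 0 < S ->
  exists2 C, 0 <= C & forall t, 0 < t <= S ->
    `|abel rho s h t| <= C * t `^ (rho * (s + gamma - 1)).
Proof.
move=> s01 dh S0; have lh := dominated_summable dh; have [ch bh] := dh.
have /andP[s0 s1] := s01.
have [C C0 hC] := bh _ S0.
have B0 : 0 < beta s gamma by exact: beta_gt0.
exists (C * (beta s gamma / rho)); first by rewrite mulr_ge0// divr_ge0// ltW.
move=> t /andP[t0 tS].
have ip := abel_integrable_power rho0 s01 gamma01 t0.
have ih := locally_summable_integrable rho0 lh s0 t0.
apply: (le_trans (ler_norm_abel ih (abel_integrableZ C ip) _)).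
  move=> tau; rewrite in_itv/= => /andP[tau0 taut]; apply: hC.
  by rewrite tau0 (le_trans (ltW taut)).
by rewrite (abelZ _ ip) (abel_power rho0 s01 gamma01 t0) mulrA.
Qed.

Lemma dominated_abel h : dominated_by_power h -> dominated_by_power (abel rho alpha h).
Proof.
move=> dh; have /andP[al0 al1] := alpha01.
split; first by apply: abel_continuous => //; exact: dominated_summable.
move=> S S0; have [C C0 hC] := abel_power_bound alpha01 dh S0.
exists (C * S `^ (rho * alpha)); first by rewrite mulr_ge0 ?powR_ge0.
move=> t tS; have /andP[t0 tS'] := tS; apply: (le_trans (hC t tS)).
rewrite -mulrA; apply: ler_wpM2l => //.
rewrite -addrA mulrDr powRD_gt0//; apply: ler_wpM2r; first exact: powR_ge0.
apply: ge0_ler_powR; rewrite ?nnegrE ?(ltW t0) ?(ltW S0)//.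
by rewrite mulr_ge0 ?ltW.
Qed.

Hypothesis dz0 : dominated_by_power z0.

Definition picard x t := z0 t + kappa * abel rho alpha (fun tau => phi tau (x tau)) t.

Lemma dominated_picard x : dominated_by_power x -> dominated_by_power (picard x).
Proof.
move=> dx; have [cz bz] := dz0.
have [ca ba] := dominated_abel (dominated_phi dx); split.
  move=> t t0; apply: continuousD; first exact: cz.
  by apply: for_continuousM; [exact: cst_continuous|exact: ca].
move=> S S0; have [C C0 hC] := bz _ S0; have [D D0 hD] := ba _ S0.
exists (C + kappa * D); first by rewrite addr_ge0// mulr_ge0.
move=> tau tauS; rewrite (le_trans (ler_normD _ _))// mulrDl lerD ?hC//.
by rewrite normrM ger0_norm// -mulrA ler_wpM2l// hD.
Qed.

(** A weight as in Bielecki's norms, with the singularity at 0 built in. *)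
Definition bielecki (k tau : R) : R := pw tau * expR (k * tau `^ rho).

Lemma bielecki_ge0 k tau : 0 <= bielecki k tau.
Proof. by rewrite mulr_ge0 ?powR_ge0 ?expR_ge0. Qed.

Lemma dominated_bielecki k : 0 <= k -> dominated_by_power (bielecki k).
Proof.
move=> k0; split.
  move=> t t0; apply: for_continuousM; first exact: continuous_powR.
  apply: (@continuous_comp _ _ _ (fun t => k * t `^ rho) expR); last exact: continuous_expR.
  by apply: for_continuousM; [exact: cst_continuous|exact: continuous_powR].
move=> S S0; exists (expR (k * S `^ rho)); first exact: expR_ge0.
move=> tau /andP[tau0 tS]; rewrite ger0_norm ?bielecki_ge0// /bielecki mulrC.
apply: ler_wpM2r; first exact: powR_ge0.
rewrite ler_expR; apply: ler_wpM2l => //.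
by apply: ge0_ler_powR; rewrite ?nnegrE ?(ltW rho0) ?(ltW tau0) ?(ltW S0).
Qed.

(** In abel rho alpha (bielecki k) t / exp(k t^rho) the factor exp(- k z),
    z = t^rho - tau^rho, is at most (k z)^(- alpha / 2): this lowers the order of
    the kernel to alpha / 2 and leaves a constant that tends to 0 with 1 / k. *)
Lemma abel_bielecki k S t : 0 < k -> 0 < t <= S ->
  abel rho alpha (bielecki k) t <=
  k `^ (- (alpha / 2)) * (beta (alpha / 2) gamma / rho * S `^ (rho * (alpha / 2))) *
  bielecki k t.
Proof.
move=> k0 /andP[t0 tS]; have /andP[al0 al1] := alpha01.
have p0 : 0 < alpha / 2 by rewrite divr_gt0.
have p01 : 0 < alpha / 2 <= 1 by rewrite p0/=; lra.
have ib := locally_summable_integrable rho0 (dominated_summable (dominated_bielecki (ltW k0))) al0 t0.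
have ip := abel_integrable_power rho0 p01 gamma01 t0.
pose c := k `^ (- (alpha / 2)) * expR (k * t `^ rho).
apply: (@le_trans _ _ (c * abel rho (alpha / 2) pw t)).
  rewrite -(abelZ _ ip); apply: le_Rintegral => //.
    exact: (abel_integrableZ c ip).
  move=> tau _.
  have [/[dup] taut /andP[tau0 tault]|taut] := boolP (0 < tau < t); last first.
    by rewrite !kern_out// !mul0r.
  rewrite !(kernE _ _ taut) /bielecki.
  set z := t `^ rho - tau `^ rho.
  have z0' : 0 < z by rewrite subr_gt0; apply: ltr_powR => //; exact: ltW.
  have -> : expR (k * tau `^ rho) = expR (k * t `^ rho) * expR (- (k * z)).
    by rewrite -expRD; congr expR; rewrite /z; ring.
  have h1 := @expRN_le_powR R (k * z) (alpha / 2) (mulr_gt0 k0 z0').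
  have {}h1 : expR (- (k * z)) <= k `^ (- (alpha / 2)) * z `^ (- (alpha / 2)).
    by rewrite -(powRM _ (ltW k0) (ltW z0')); apply: h1; rewrite (ltW p0)/=; lra.
  have -> : z `^ (alpha / 2 - 1) = z `^ (alpha - 1) * z `^ (- (alpha / 2)).
    by rewrite -powRD_gt0//; congr (_ `^ _); field.
  rewrite /c -/(pw tau).
  have := powR_ge0 tau (rho - 1); have := powR_ge0 z (alpha - 1).
  have : 0 <= pw tau by exact: powR_ge0.
  have := expR_ge0 (k * t `^ rho).
  move: h1; move: (expR (- (k * z))) (expR (k * t `^ rho)) (k `^ (- (alpha / 2)))
    (z `^ (- (alpha / 2))) (z `^ (alpha - 1)) (tau `^ (rho - 1)) (pw tau).
  move=> e1 e2 kp zp za tr pt h1 e20 pt0 za0 tr0.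
  rewrite (_ : tr * za * (pt * (e2 * e1)) = (tr * za * pt * e2) * e1); last by ring.
  rewrite (_ : tr * (za * zp) * (kp * e2 * pt) = (tr * za * pt * e2) * (kp * zp)); last by ring.
  by apply: ler_wpM2l => //; rewrite !mulr_ge0.
rewrite /pw (abel_power rho0 p01 gamma01 t0) /c /bielecki -/(pw t).
have B0 : 0 < beta (alpha / 2) gamma by exact: beta_gt0.
have -> : t `^ (rho * (alpha / 2 + gamma - 1)) = t `^ (rho * (alpha / 2)) * pw t.
  by rewrite /pw -powRD_gt0//; congr (_ `^ _); ring.
have tSp : t `^ (rho * (alpha / 2)) <= S `^ (rho * (alpha / 2)).
  apply: ge0_ler_powR; rewrite ?nnegrE ?(ltW t0) ?(le_trans (ltW t0) tS)//.
  by rewrite mulr_ge0 ?ltW.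
have := expR_ge0 (k * t `^ rho); have := powR_ge0 k (- (alpha / 2)).
have : 0 <= pw t by exact: powR_ge0.
have : 0 <= beta (alpha / 2) gamma / rho by rewrite divr_ge0 ?ltW.
move: tSp; move: (beta _ _ / rho) (k `^ _) (expR _) (t `^ _) (S `^ _) (pw t).
move=> b kp e tp sp pt tsp b0 pt0 kp0 e0.
rewrite (_ : kp * e * (b * (tp * pt)) = (kp * e * b * pt) * tp); last by ring.
rewrite (_ : kp * (b * sp) * (pt * e) = (kp * e * b * pt) * sp); last by ring.
by apply: ler_wpM2l => //; rewrite !mulr_ge0.
Qed.

Lemma picard_contraction S : 0 < S -> exists2 k, 0 < k & forall x y M, 0 <= M ->
  dominated_by_power x -> dominated_by_power y ->
  (forall tau, 0 < tau <= S -> `|x tau - y tau| <= M * bielecki k tau) ->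
  forall t, 0 < t <= S -> `|picard x t - picard y t| <= M / 2 * bielecki k t.
Proof.
move=> S0; have /andP[al0 al1] := alpha01.
have p0 : 0 < alpha / 2 by rewrite divr_gt0.
have p01 : 0 < alpha / 2 <= 1 by rewrite p0/=; lra.
pose D := 2 * kappa * A * (beta (alpha / 2) gamma / rho * S `^ (rho * (alpha / 2))).
have B0 : 0 < beta (alpha / 2) gamma by exact: beta_gt0.
have D0 : 0 <= D.
  apply: mulr_ge0; first by rewrite !mulr_ge0.
  by rewrite mulr_ge0 ?powR_ge0// divr_ge0 ?ltW.
have D1 : 0 < D + 1 by rewrite ltr_wpDl.
(* so that D k^(- alpha / 2) = D / (D + 1) <= 1 *)
pose k := (D + 1) `^ (alpha / 2)^-1.
have k0 : 0 < k by exact: powR_gt0.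
have kD : k `^ (- (alpha / 2)) = (D + 1)^-1.
  by rewrite powRN powR_root// ltW.
exists k => // x y M M0 dx dy xy t /[dup] tS /andP[t0 _].
have dX := dominated_phi dx; have dY := dominated_phi dy.
have iX := locally_summable_integrable rho0 (dominated_summable dX) al0 t0.
have iY := locally_summable_integrable rho0 (dominated_summable dY) al0 t0.
have iB := locally_summable_integrable rho0 (dominated_summable (dominated_bielecki (ltW k0))) al0 t0.
rewrite /picard opprD addrACA subrr add0r -mulrBr normrM (ger0_norm kappa0).
have -> : abel rho alpha (fun tau => phi tau (x tau)) t - abel rho alpha (fun tau => phi tau (y tau)) t =
   abel rho alpha (fun tau => phi tau (x tau) + -1 * phi tau (y tau)) t.
  by rewrite abelD ?abelZ ?mulN1r//; exact: abel_integrableZ.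
have H : `|abel rho alpha (fun tau => phi tau (x tau) + -1 * phi tau (y tau)) t| <=
   A * M * abel rho alpha (bielecki k) t.
  rewrite -(abelZ _ iB); apply: ler_norm_abel.
  - by apply: abel_integrableD => //; exact: abel_integrableZ.
  - exact: abel_integrableZ.
  move=> tau; rewrite in_itv/= => /andP[tau0 taut]; rewrite mulN1r.
  rewrite (le_trans (lip _ _ tau0))// -mulrA; apply: ler_wpM2l => //; apply: xy.
  by rewrite tau0 (le_trans (ltW taut))//; have /andP[] := tS.
apply: (le_trans (ler_wpM2l kappa0 H)).
have H2 := abel_bielecki k0 tS; rewrite kD in H2.
have AM0 : 0 <= A * M by rewrite mulr_ge0.
apply: (le_trans (ler_wpM2l kappa0 (ler_wpM2l AM0 H2))).
have DE : kappa * A * (beta (alpha / 2) gamma / rho * S `^ (rho * (alpha / 2))) = D / 2.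
  by rewrite /D; field; rewrite gt_eqF.
move: DE (bielecki_ge0 k t) ; move: (_ / rho * _) (bielecki k t) => q b DE b0.
rewrite (_ : kappa * (A * M * ((D + 1)^-1 * q * b)) = (kappa * A * q) * (D + 1)^-1 * M * b); last by ring.
rewrite DE; apply: ler_wpM2r => //; rewrite mulrC; apply: ler_wpM2l => //.
rewrite ler_pdivrMr//; lra.
Qed.

Let iterate n : R -> R := iter n picard z0.

Let dominated_iterate n : dominated_by_power (iterate n).
Proof. by elim: n => [|n IH] //; exact: dominated_picard. Qed.

Let le_pw_bielecki k tau : 0 <= k -> pw tau <= bielecki k tau.
Proof.
move=> k0; rewrite /bielecki -[leLHS]mulr1; apply: ler_wpM2l; first exact: powR_ge0.
by apply: (le_trans _ (expR_ge1Dx _)); rewrite lerDl mulr_ge0 ?powR_ge0.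
Qed.

(* The contraction property is carried along, so that the same k serves for the
   limit. *)
Let iterate_step S : 0 < S -> exists k, exists M, [/\ 0 < k, 0 <= M,
  (forall x y N, 0 <= N -> dominated_by_power x -> dominated_by_power y ->
    (forall tau, 0 < tau <= S -> `|x tau - y tau| <= N * bielecki k tau) ->
    forall t, 0 < t <= S -> `|picard x t - picard y t| <= N / 2 * bielecki k t) &
  forall n t, 0 < t <= S ->
    `|iterate n.+1 t - iterate n t| <= M * bielecki k t * 2^-1 ^+ n].
Proof.
move=> S0; have [k k0 contr] := picard_contraction S0.
have [_ /(_ _ S0)[C0 C00 hC0]] := dominated_iterate 0.
have [_ /(_ _ S0)[C1 C10 hC1]] := dominated_iterate 1.
exists k, (C1 + C0); split=> //; first exact: addr_ge0.
elim=> [|n IH] t tS.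
  rewrite expr0 mulr1 (le_trans (ler_normB _ _))// mulrDl lerD//.
    by rewrite (le_trans (hC1 _ tS))// ler_wpM2l// le_pw_bielecki// ltW.
  by rewrite (le_trans (hC0 _ tS))// ler_wpM2l// le_pw_bielecki// ltW.
rewrite exprS.
rewrite -[leRHS](_ : (C1 + C0) * 2^-1 ^+ n / 2 * bielecki k t = _); last first.
  by move: (bielecki _ _) (_ ^+ n) => b q; ring.
apply: (contr (iterate n.+1) (iterate n) _ _ (dominated_iterate _) (dominated_iterate _)) tS.
  by rewrite mulr_ge0 ?addr_ge0// exprn_ge0.
by move=> tau tauS; rewrite mulrAC; exact: IH.
Qed.

(** The iterates converge locally uniformly on (0, oo), with an error that is a
    multiple of the weight on each (0, S]; the contraction property then shows
    that x - picard x is smaller than every 2^(- n). *)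
Lemma volterra_solution :
  exists x, dominated_by_power x /\ forall t, 0 < t -> x t = picard x t.
Proof.
pose x t := limn (fun n => iterate n t).
have est S : 0 < S -> exists k, exists M, [/\ 0 < k, 0 <= M,
    (forall x y N, 0 <= N -> dominated_by_power x -> dominated_by_power y ->
      (forall tau, 0 < tau <= S -> `|x tau - y tau| <= N * bielecki k tau) ->
      forall t, 0 < t <= S -> `|picard x t - picard y t| <= N / 2 * bielecki k t) &
    forall n t, 0 < t <= S -> `|x t - iterate n t| <= 2 * (M * bielecki k t) * 2^-1 ^+ n].
  move=> S0; have [k [M [k0 M0 contr step]]] := iterate_step S0.
  exists k, M; split=> // n t tS.
  by apply: half_exp_lim => m; exact: step.
have cx : pos_continuous x.
  move=> t t0; pose S := 2 * t; have S0 : 0 < S by rewrite mulr_gt0.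
  have [k [M [k0 M0 _ hx]]] := est S S0.
  have [cb _] := dominated_bielecki (ltW k0).
  have t2 : 0 < t / 2 by rewrite divr_gt0.
  have [B B0 hB] := @pos_continuous_bounded R _ (t / 2) S cb t2.
  apply: continuous_uniform_approx => e e0.
  have [n hn] := half_exp_small (2 * (M * B)) e0.
  exists (iterate n); split; first by case: (dominated_iterate n) => + _; exact.
  near=> s.
  have s2 : t / 2 < s.
    by near: s; apply: lt_nbhsr; rewrite ltr_pdivrMr//; lra.
  have sS : s < S by near: s; apply: lt_nbhsl; rewrite /S; lra.
  have sS' : 0 < s <= S by rewrite (lt_trans t2)//= ltW.
  apply: (le_trans (hx n s sS')); apply: (le_trans _ hn).
  apply: ler_wpM2r; first by rewrite exprn_ge0.
  apply: ler_wpM2l => //; apply: ler_wpM2l => //.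
  by rewrite (le_trans (ler_norm _))// hB// !ltW.
have dx : dominated_by_power x.
  split=> // S S0; have [k [M [k0 M0 _ hx]]] := est S S0.
  have [_ /(_ _ S0)[C C0 hC]] := dz0.
  have [_ /(_ _ S0)[D D0 hD]] := dominated_bielecki (ltW k0).
  exists (2 * (M * D) + C); first by rewrite addr_ge0// !mulr_ge0.
  move=> tau tauS; rewrite -[x tau](subrK (z0 tau)) (le_trans (ler_normD _ _))//.
  rewrite mulrDl lerD ?hC// (le_trans (hx 0%N _ tauS))// expr0 mulr1.
  rewrite -!mulrA; apply: ler_wpM2l => //; apply: ler_wpM2l => //.
  by rewrite (le_trans (ler_norm _))// hD.
exists x; split=> // t t0.
have [k [M [k0 M0 contr hx]]] := est t t0.
have tt : 0 < t <= t by rewrite t0 lexx.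
apply/eqP; rewrite -subr_eq0; apply/eqP.
apply: (@half_exp_eq0 _ (2 * (M * bielecki k t))) => n.
have -> : x t - picard x t =
    (x t - iterate n.+1 t) - (picard x t - picard (iterate n) t).
  by rewrite /iterate iterS; ring.
rewrite (le_trans (ler_normB _ _))//.
pose N := 2 * M * 2^-1 ^+ n.
have N0 : 0 <= N by rewrite !mulr_ge0// exprn_ge0.
have H1 := hx n.+1 t tt.
have H2 : `|picard x t - picard (iterate n) t| <= N / 2 * bielecki k t.
  apply: contr => // tau tauS; rewrite /N (le_trans (hx n tau tauS))//.
  by rewrite mulrA mulrAC.
apply: (le_trans (lerD H1 H2)); rewrite /N exprS.
by move: (bielecki k t) (_ ^+ n) => b q; rewrite le_eqVlt; apply/orP; left; apply/eqP; field.
Unshelve. all: by end_near. Qed.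
End volterra.

(** * Behaviour at the origin and inversion of the delta derivative *)

Section origin.
Context {R : realType}.
Notation mu := (@lebesgue_measure R).
Implicit Types (a b r s t tau rho sigma : R) (h u v y : R -> R).

Lemma cvg_at_right0_power u (l K p : R) : 0 < p ->
  (forall t, 0 < t <= 1 -> `|u t - l| <= K * t `^ p) -> u t @[t --> 0^'+] --> l.
Proof.
move=> p0 hu.
have h0 : K * t `^ p @[t --> 0^'+] --> 0.
  rewrite -[X in _ --> X](mulr0 K); apply: cvgM; first exact: cvg_cst.
  exact: powR_cvg0.
apply/cvgrPdist_le => e e0; move/cvgrPdist_le : h0 => /(_ e e0) h0.
near=> t.
have t0 : 0 < t by near: t; exact: nbhs_right_gt.
have t1 : t <= 1 by near: t; exact: nbhs_right_le.
rewrite distrC; apply: (le_trans (hu t _)); first by rewrite t0.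
apply: (le_trans (ler_norm _)); rewrite -normrN -sub0r.
by near: t.
Unshelve. all: by end_near. Qed.

Lemma eq_cvg_at_right0 u v (l : R) : (forall t, 0 < t -> u t = v t) ->
  u t @[t --> 0^'+] --> l -> v t @[t --> 0^'+] --> l.
Proof.
move=> uv; apply: cvg_trans; apply: near_eq_cvg; near=> t.
by apply: uv; near: t; exact: nbhs_right_gt.
Unshelve. all: by end_near. Qed.

Lemma near_pos_eq u v t : 0 < t -> (forall s, 0 < s -> u s = v s) ->
  {near t, u =1 v}.
Proof. by move=> t0 uv; near=> s; apply: uv; near: s; exact: lt_nbhsr.
Unshelve. all: by end_near. Qed.

Lemma eq_derivable_pos u v t : 0 < t -> (forall s, 0 < s -> u s = v s) ->
  derivable u t 1 -> derivable v t 1.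
Proof. by move=> t0 uv; apply: near_eq_derivable; exact: near_pos_eq. Qed.

Lemma eq_delta rho u v t : 0 < t -> (forall s, 0 < s -> u s = v s) ->
  delta rho u t = delta rho v t.
Proof.
by move=> t0 uv; rewrite /delta !derive1E (near_eq_derive _ (near_pos_eq t0 uv)).
Qed.

(** Absolute continuity of the integral. *)
Lemma katugampola1_cvg0 rho h : locally_summable rho h ->
  katugampola rho 1 h t @[t --> 0^'+] --> 0.
Proof.
move=> hh; have [ch ih] := hh.
pose f tau := kern rho 1 2 tau * h tau.
have if1 : mu.-integrable `[0, 1] (EFin \o f).
  by apply: integrableS (ih 2 _) => //.
have := cvg_at_right_filter (parameterized_integral_cvg_left ltr01 if1).
apply: cvg_trans; apply: near_eq_cvg; near=> t.
have t0 : 0 < t by near: t; exact: nbhs_right_gt.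
have t1 : t <= 1 by near: t; exact: nbhs_right_le.
rewrite katugampola1_integral// /parameterized_integral.
rewrite -Rintegral_itv_obnd_cbnd; last first.
  by apply: integrableS (ih 2 _) => //.
apply: eq_Rintegral => tau; rewrite inE/= in_itv/= => /andP[tau0 taut].
rewrite /f kern1E// tau0/=; lra.
Unshelve. all: by end_near. Qed.

Lemma is_cst_pos u : (forall t, 0 < t -> is_derive t 1 u 0) ->
  forall s t, 0 < s -> 0 < t -> u s = u t.
Proof.
move=> du.
have H s t : 0 < s -> s < t -> u s = u t.
  move=> s0 st; have [||c _] := @MVT R u (fun=> 0) s t st.
  - by move=> x; rewrite in_itv/= => /andP[sx _]; apply: du; exact: lt_trans sx.
  - apply: continuous_in_subspaceT => x; rewrite inE/= in_itv/= => /andP[sx _].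
    apply: differentiable_continuous; apply/derivable1_diffP.
    by apply: (@ex_derive _ _ _ _ _ _ _ (du x _)); exact: lt_le_trans sx.
  by rewrite mul0r => /eqP; rewrite subr_eq0 => /eqP.
by move=> s t s0 t0; have [st|ts|->//] := ltgtP s t; [exact: H|apply/esym; exact: H].
Qed.

(** The difference of the two sides has derivative 0 on (0, oo) and limit 0 at
    the origin. *)
Lemma katugampola1_delta rho y (c : R) : (forall t, 0 < t -> derivable y t 1) ->
  locally_summable rho (delta rho y) -> y t @[t --> 0^'+] --> c ->
  forall t, 0 < t -> y t = c + katugampola rho 1 (delta rho y) t.
Proof.
move=> dy sd yc; set k := katugampola rho 1 (delta rho y).
have yk0 : (fun t => y t - k t) t @[t --> 0^'+] --> c - 0.
  by apply: cvgB => //; exact: katugampola1_cvg0.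
have cst : forall s t, 0 < s -> 0 < t -> y s - k s = y t - k t.
  apply: (@is_cst_pos (fun t => y t - k t)) => t t0.
  have [dk] := katugampola1_derive sd t0; rewrite -/k /delta => /(mulfI _) E.
  have {}E : derive1 k t = derive1 y t.
    by apply: E; rewrite gt_eqF// powR_gt0.
  have := is_deriveB (derivableP (dy t t0)) (derivableP dk).
  by rewrite -!derive1E E subrr.
move=> t t0; have : (fun t => y t - k t) s @[s --> 0^'+] --> y t - k t.
  by apply: (@eq_cvg_at_right0 (fun=> y t - k t)) => [s s0|]; [exact: cst|exact: cvg_cst].
move=> yk; have := cvg_unique _ yk0 yk; rewrite subr0 => /(_ _) ->//.
by rewrite subrK.
Qed.

Lemma within_pos_continuous u : {within `]0, +oo[, continuous u} -> pos_continuous u.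
Proof.
rewrite continuous_open_subspace; last exact: interval_open.
by move=> cu t t0; apply: cu; rewrite inE/= in_itv/= t0.
Qed.

Lemma kern1_le rho s t tau : 0 < rho -> s <= 1 -> 0 < t ->
  kern rho 1 t tau <= (t `^ rho) `^ (1 - s) * kern rho s t tau.
Proof.
move=> rho0 s1 t0.
have [/[dup] taut /andP[tau0 tault]|taut] := boolP (0 < tau < t); last first.
  by rewrite !kern_out// mulr0.
rewrite (kern1E rho taut) (kernE _ _ taut) mulrCA.
set z := t `^ rho - tau `^ rho.
have z0 : 0 < z by rewrite subr_gt0; apply: ltr_powR => //; exact: ltW.
have tp : 0 < t `^ rho by exact: powR_gt0.
rewrite -[leLHS]mulr1; apply: ler_wpM2l; first exact: powR_ge0.
have E : (t `^ rho) `^ (1 - s) * (t `^ rho) `^ (s - 1) = 1.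
  by rewrite -powRD_gt0// (_ : 1 - s + (s - 1) = 0) ?powRr0//; ring.
rewrite -[leLHS]E.
apply: ler_wpM2l; first exact: powR_ge0.
by apply: ler_powR_neg => //; rewrite ?subr_le0// gerBl powR_ge0.
Qed.

(** For s <= 1 the kernel of order s is bounded below by a multiple of the kernel
    of order 1. *)
Lemma defined_locally_summable rho s h : 0 < rho -> s <= 1 -> s != 0 ->
  pos_continuous h -> katugampola_defined rho s h -> locally_summable rho h.
Proof.
move=> rho0 s1 s0 ch /katugampola_definedP[/eqP|ih]; first by rewrite (negbTE s0).
split=> // t t0.
have := @integrableZl _ _ _ mu _ measurableT ((t `^ rho) `^ (1 - s)) _ (ih t t0).
apply: le_integrable => //.
  by apply/measurable_EFinP; exact: measurable_kernM.
move=> tau _; rewrite /= lee_fin !normrM mulrA; apply: ler_wpM2r => //.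
rewrite !ger0_norm ?powR_ge0 ?kern_ge0//; exact: kern1_le.
Qed.
End origin.

(** * From the Volterra equation to the initial value problem *)

Section ivp.
Context {R : realType}.
Variables (rho alpha beta gamma x0 : R) (phi : R -> R -> R) (x : R -> R).
Hypotheses (rho0 : 0 < rho) (halpha : 0 < alpha < 1) (hbeta : 0 <= beta <= 1).
Hypothesis hgamma : gamma = alpha + beta * (1 - alpha).
Let w t := phi t (x t).
Hypotheses (dx : dominated_by_power rho gamma x) (dw : dominated_by_power rho gamma w).
Let z0 t := x0 / Gamma gamma * (t `^ rho / rho) `^ (gamma - 1).
Hypothesis xE : forall t, 0 < t -> x t = z0 t + katugampola rho alpha w t.

Let sigma := beta * (1 - alpha).

Let sigma01 : 0 <= sigma < 1.
Proof. by rewrite /sigma; move: halpha hbeta => /andP[? ?] /andP[? ?]; apply/andP; split; nra. Qed.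

Let gamma01 : 0 < gamma <= 1.
Proof. by rewrite hgamma; move: halpha hbeta => /andP[? ?] /andP[? ?]; apply/andP; split; nra. Qed.

Let innerE : (1 - alpha) * (1 - beta) = 1 - gamma.
Proof. by rewrite hgamma; ring. Qed.

Let alpha_sigma : 1 - gamma + alpha = 1 - sigma.
Proof. by rewrite hgamma /sigma; ring. Qed.

Let lx : locally_summable rho x := dominated_summable rho0 gamma01 dx.
Let lw : locally_summable rho w := dominated_summable rho0 gamma01 dw.

Let alpha01 : 0 < alpha <= 1.
Proof. by move: halpha => /andP[-> /ltW]. Qed.

Let summable_z : locally_summable rho (fun t => (t `^ rho / rho) `^ (gamma - 1)).
Proof.
have powE : (fun tau => (tau `^ rho / rho) `^ (gamma - 1)) =
    (fun tau => rho `^ (1 - gamma) * tau `^ (rho * (gamma - 1))).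
  by apply/funext => tau; exact: powR_weight.
by rewrite powE; apply: locally_summableZ; exact: locally_summable_power.
Qed.

Lemma katugampola_cvg0 s : 0 < s <= 1 -> 0 < s + gamma - 1 ->
  katugampola rho s w t @[t --> 0^'+] --> 0.
Proof.
move=> s01 sg; have [C C0 hC] := abel_power_bound rho0 gamma01 s01 dw ltr01.
have s0 : s != 0 by case/andP: s01 => s0 _; rewrite gt_eqF.
apply: (@cvg_at_right0_power _ _ _ (`|rho `^ (1 - s) / Gamma s| * C) (rho * (s + gamma - 1))).
  by rewrite mulr_gt0.
move=> t t1; rewrite subr0 (katugampolaE _ _ _ s0) normrM -mulrA.
by apply: ler_wpM2l => //; exact: hC.
Qed.

(** I^(1 - gamma) maps the homogeneous solution to the constant x0, and the orders
    1 - gamma and alpha add up to 1 - sigma. *)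
Lemma inner_volterra t : 0 < t ->
  katugampola rho (1 - gamma) x t = x0 + katugampola rho (1 - sigma) w t.
Proof.
move=> t0; have /andP[g0 g1] := gamma01; have /andP[al0 al1] := halpha.
have /andP[s0 s1] := sigma01.
have g10 : 0 <= 1 - gamma by rewrite subr_ge0.
rewrite (eq_katugampola rho (1 - gamma) t0 xE).
have lk : locally_summable rho (katugampola rho alpha w).
  by apply: katugampola_locally_summable => //; rewrite !ltW.
rewrite (katugampolaD rho0 g10 (locally_summableZ _ summable_z) lk t0).
rewrite (katugampolaZ _ rho0 g10 summable_z t0) (katugampola_power rho0 gamma01 t0).
rewrite (mulfVK (lt0r_neq0 (Gamma_gt0 gamma01))); congr (_ + _).
rewrite (katugampola_comp rho0 g10 (ltW al0) _ lw t0) ?alpha_sigma//.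
lra.
Qed.

Let y := katugampola rho (1 - gamma) x.

(** I^(1 - sigma) w is O(t^(rho alpha)) because 1 - sigma + gamma - 1 = alpha. *)
Lemma inner_cvg : y t @[t --> 0^'+] --> x0.
Proof.
apply: (@eq_cvg_at_right0 _ (fun t => x0 + katugampola rho (1 - sigma) w t)).
  by move=> t t0; rewrite /y inner_volterra.
rewrite -[X in _ --> X]addr0; apply: cvgD; first exact: cvg_cst.
have /andP[s0 s1] := sigma01; have /andP[al0 al1] := halpha.
apply: katugampola_cvg0; first by apply/andP; split; lra.
by rewrite (_ : 1 - sigma + gamma - 1 = alpha)// -alpha_sigma; ring.
Qed.

Let lim_y : lim (y t @[t --> 0^'+]) = x0.
Proof. by apply/cvg_lim => //; exact: inner_cvg. Qed.

Let summable_y : locally_summable rho (katugampola rho (1 - sigma) w).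
Proof.
apply: katugampola_locally_summable => //.
by have /andP[s0 s1] := sigma01; apply/andP; split; lra.
Qed.

Let y_sub t : 0 < t -> y t - x0 = katugampola rho (1 - sigma) w t.
Proof. by move=> t0; rewrite /y inner_volterra// addrAC subrr add0r. Qed.

Lemma outer_volterra t : 0 < t ->
  katugampola rho sigma (fun s => y s - x0) t = katugampola rho 1 w t.
Proof.
move=> t0; have /andP[s0 s1] := sigma01.
rewrite (eq_katugampola rho sigma t0 y_sub).
rewrite (katugampola_comp rho0 s0 _ _ lw t0); last 2 first.
- by rewrite subr_ge0 ltW.
- by rewrite addrC subrK.
by rewrite addrC subrK.
Qed.

Let regularE t : hilfer_regular rho alpha beta x t =
  katugampola rho sigma (fun s => y s - x0) t.
Proof. by rewrite /hilfer_regular /hilfer_inner innerE -/y lim_y. Qed.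

Let regular_volterra t : 0 < t -> katugampola rho 1 w t = hilfer_regular rho alpha beta x t.
Proof. by move=> t0; rewrite regularE outer_volterra. Qed.

Lemma volterra_ext_defined : hilfer_katugampola_ext_defined rho alpha beta x.
Proof.
have /andP[s0 s1] := sigma01; have /andP[g0 g1] := gamma01.
rewrite /hilfer_katugampola_ext_defined /hilfer_inner innerE -/y lim_y; split.
- by apply: locally_summable_defined; rewrite ?subr_ge0.
- exact: inner_cvg.
- apply: (@eq_katugampola_defined _ rho sigma (katugampola rho (1 - sigma) w)).
    by move=> t t0; rewrite y_sub.
  exact: locally_summable_defined.
- move=> t t0; apply: (eq_derivable_pos t0 regular_volterra).
  by have [] := katugampola1_derive lw t0.
Qed.

Lemma volterra_ext t : 0 < t -> hilfer_katugampola_ext rho alpha beta x t = w t.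
Proof.
move=> t0; rewrite /hilfer_katugampola_ext -(eq_delta rho t0 regular_volterra).
by have [] := katugampola1_derive lw t0.
Qed.

(** For sigma > 0, I^sigma (delta y) and w have the same integral of order 1 on
    every (0, t); both are continuous, so that they agree everywhere and not just
    almost everywhere. *)
Lemma volterra_classical : hilfer_katugampola_classical rho alpha beta x ->
  forall t, 0 < t -> hilfer_katugampola rho alpha beta x t = w t.
Proof.
rewrite /hilfer_katugampola_classical /hilfer_katugampola /hilfer_inner innerE -/y -/sigma.
move=> [_ dy /within_pos_continuous cd id_] t t0; have /andP[s0 s1] := sigma01.
have [sE|sn0] := eqVneq sigma 0.
  rewrite sE katugampola0.
  have yE s : 0 < s -> y s = x0 + katugampola rho 1 w s.
    by move=> ps; rewrite /y (inner_volterra ps) sE subr0.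
  have [dk kE] := katugampola1_derive lw t0.
  rewrite (eq_delta rho t0 yE) -[RHS]kE /delta; congr (_ * _).
  have := is_deriveD (is_derive_cst x0 t 1) (derivableP dk); rewrite add0r => D.
  rewrite !derive1E; exact: (@derive_val _ _ _ _ _ _ _ D).
have ld := defined_locally_summable rho0 (ltW s1) sn0 cd id_.
have s01 : 0 <= sigma <= 1 by rewrite s0 ltW.
have yE s : 0 < s -> y s - x0 = katugampola rho 1 (delta rho y) s.
  by move=> ps; rewrite (katugampola1_delta dy ld inner_cvg ps) addrAC subrr add0r.
have E s : 0 < s ->
    katugampola rho 1 (katugampola rho sigma (delta rho y)) s = katugampola rho 1 w s.
  move=> ps; rewrite -(katugampola_comm1 rho0 s01 ld ps) -(outer_volterra ps).
  by apply/esym; exact: eq_katugampola.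
have lsd := katugampola_locally_summable rho0 s01 ld.
have [_ <-] := katugampola1_derive lsd t0.
rewrite (eq_delta rho t0 E).
by have [] := katugampola1_derive lw t0.
Qed.

Lemma volterra_ivp : ivp_solution rho alpha beta gamma x0 phi x.
Proof.
split.
- exact: volterra_ext_defined.
- exact: volterra_ext.
- exact: volterra_classical.
- exact: inner_cvg.
Qed.

(** The weight cancels the singularity of the homogeneous solution exactly and
    makes the fractional integral O(t^(rho alpha)). *)
Lemma volterra_weighted : weighted_space_oo gamma rho x.
Proof.
have /andP[g0 g1] := gamma01; have /andP[al0 al1] := halpha.
set u := weighted gamma rho x.
have uE t : 0 < t -> u t = x0 / Gamma gamma +
    (t `^ rho / rho) `^ (1 - gamma) * katugampola rho alpha w t.
  move=> t0; rewrite /u /weighted (xE t0) mulrDr /z0; congr (_ + _).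
  have s0 : 0 < t `^ rho / rho by rewrite divr_gt0// powR_gt0.
  by rewrite mulrCA -powRD_gt0// (_ : 1 - gamma + (gamma - 1) = 0) ?powRr0 ?mulr1//; ring.
have ucvg : u t @[t --> 0^'+] --> x0 / Gamma gamma.
  have [C C0 hC] := abel_power_bound rho0 gamma01 alpha01 dw ltr01.
  apply: (@cvg_at_right0_power _ _ _
    (rho `^ (gamma - 1) * (`|rho `^ (1 - alpha) / Gamma alpha| * C)) (rho * alpha)).
    by rewrite mulr_gt0.
  move=> t t1; have /andP[t0 _] := t1.
  rewrite (uE _ t0) addrAC subrr add0r normrM ger0_norm ?powR_ge0//.
  rewrite (katugampolaE _ _ _ (lt0r_neq0 al0)) normrM.
  rewrite powRM ?powR_ge0 ?invr_ge0 ?(ltW rho0)// powRV ?(ltW rho0)// -powRN opprB -powRrM.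
  apply: (@le_trans _ _ (t `^ (rho * (1 - gamma)) * rho `^ (gamma - 1) *
      (`|rho `^ (1 - alpha) / Gamma alpha| * (C * t `^ (rho * (alpha + gamma - 1)))))).
    apply: ler_wpM2l; first by rewrite mulr_ge0 ?powR_ge0.
    by apply: ler_wpM2l => //; exact: hC.
  have -> : t `^ (rho * alpha) = t `^ (rho * (1 - gamma)) * t `^ (rho * (alpha + gamma - 1)).
    by rewrite -powRD_gt0//; congr (_ `^ _); ring.
  move: (t `^ _) (t `^ _) (rho `^ (gamma - 1)) `|_ / _| => p q r v.
  by rewrite le_eqVlt; apply/orP; left; apply/eqP; ring.
have ext0 : extend0 u 0 = x0 / Gamma gamma.
  by rewrite /extend0 eqxx; apply/cvg_lim.
have extE t : 0 < t -> u t = extend0 u t.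
  by move=> t0; rewrite /extend0 gt_eqF.
apply/continuous_within_itvcyP; split; last by rewrite ext0; exact: eq_cvg_at_right0 ucvg.
move=> t; rewrite in_itv/= andbT => t0.
have cu : {for t, continuous u}.
  apply: for_continuousM; last by case: dx => + _; apply.
  apply: for_continuous_powR; last by rewrite divr_gt0// powR_gt0.
  by apply: for_continuousM; [exact: continuous_powR|exact: cst_continuous].
rewrite /continuous_at -extE//; apply: cvg_trans cu; apply: near_eq_cvg.
exact: near_pos_eq.
Qed.
End ivp.

(** * Existence *)

Theorem theorem4p4 (R : realType) (alpha beta gamma rho x0 A lambda T : R)
    (phi : R -> R -> R) (f g psi : R -> R)
    (halpha : 0 < alpha < 1) (hbeta : 0 <= beta <= 1)
    (hgamma : gamma = alpha + beta * (1 - alpha))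
    (hrho : 0 < rho)
    (hphi : {within [set p : R * R | 0 < p.1],
               continuous (fun p : R * R => phi p.1 p.2)})
    (hA : 0 < A)
    (hlip : forall t x y : R, 0 < t -> `|phi t x - phi t y| <= A * `|x - y|)
    (hlambda : 0 <= lambda < 1) (hT : 0 < T)
    (hM : continuous_bounded_map gamma rho T (superposition lambda phi))
    (hf : {within `[0, +oo[, continuous f})
    (hg : {within `[0, +oo[, continuous g})
    (hpsi : {within `[0, +oo[, continuous psi})
    (hf0 : forall t : R, 0 <= t -> 0 <= f t)
    (hg0 : forall t : R, 0 <= t -> 0 <= g t)
    (hpsi0 : forall t : R, 0 <= t -> 0 <= psi t)
    (hgrowth : forall t x : R, 0 < t -> `|phi t x| <= g t * f `|x| + psi t)
    (hfle : forall eta : R, 0 <= eta -> f eta <= eta) :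
  exists x : R -> R,
    weighted_space_oo gamma rho x /\
    ivp_solution rho alpha beta gamma x0 phi x.
Proof.
have /andP[al0 al1] := halpha; have /andP[b0 b1] := hbeta.
have alpha01 : 0 < alpha <= 1 by rewrite al0 ltW.
have gamma01 : 0 < gamma <= 1 by rewrite hgamma; apply/andP; split; nra.
have f0 : f 0 = 0.
  by apply/eqP; rewrite eq_le hf0// andbT; exact: hfle.
have phi0 S : 0 < S -> exists C, forall t, 0 < t <= S -> `|phi t 0| <= C.
  move=> S0.
  have cpsi : {within `[0, S], continuous psi}.
    by apply: continuous_subspaceW hpsi => t /=; rewrite !in_itv/= => /andP[->].
  have [c _ hc] := EVT_max (ltW S0) cpsi.
  exists (psi c) => t /andP[t0 tS]; rewrite (le_trans (hgrowth t 0 t0))//.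
  by rewrite normr0 f0 mulr0 add0r hc// in_itv/= (ltW t0).
have kappa0 : 0 <= rho `^ (1 - alpha) / Gamma alpha.
  by rewrite divr_ge0 ?powR_ge0// ltW// Gamma_gt0.
pose z t := x0 / Gamma gamma * (rho `^ (1 - gamma) * t `^ (rho * (gamma - 1))).
have zE t : z t = x0 / Gamma gamma * (t `^ rho / rho) `^ (gamma - 1).
  by rewrite (powR_weight _ _ hrho).
have dz : dominated_by_power rho gamma z.
  split=> [t t0|S S0].
    apply: for_continuousM; first exact: cst_continuous.
    by apply: for_continuousM; [exact: cst_continuous|exact: continuous_powR].
  exists (`|x0 / Gamma gamma| * rho `^ (1 - gamma)); first by rewrite mulr_ge0 ?powR_ge0.
  move=> t _; rewrite normrM [X in _ * X]ger0_norm; first by rewrite mulrA.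
  by rewrite mulr_ge0 ?powR_ge0.
have [x [dx xE]] := volterra_solution hrho alpha01 gamma01 (ltW hA) kappa0 hphi hlip phi0 dz.
have dw := dominated_phi hrho gamma01 (ltW hA) hphi hlip phi0 dx.
have {}xE t : 0 < t -> x t = x0 / Gamma gamma * (t `^ rho / rho) `^ (gamma - 1) +
    katugampola rho alpha (fun s => phi s (x s)) t.
  move=> t0; rewrite (xE t t0) /picard zE; congr (_ + _).
  by rewrite (katugampolaE _ _ _ (lt0r_neq0 al0)).
exists x; split; first exact: (volterra_weighted hrho halpha hbeta hgamma dx dw xE).
exact: (volterra_ivp hrho halpha hbeta hgamma dx dw xE).
Qed.
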